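(* If two rings $A$ and $B$ (objects of $GK^G$) are functional Morita equivalent, then they are isomorphic in $GK^G$.
   Context: Throughout, $G$ is a discrete group. All rings are associative, not necessarily commutative or unital, carry a $G$-action and are quadratik (every element a finite sum of products); ring homomorphisms are $G$-equivariant. A right functional $A$-module is a right $A$-module $\mathcal E$ with a $G$-action $S$ ($S_g(\xi a)=S_g(\xi)\alpha_g(a)$) and a $G$-invariant left $A$-submodule $\Theta_A(\mathcal E)\subseteq\mathrm{Hom}_A(\mathcal E,A)$. $\mathcal K_A(\mathcal E)$ is the ring of finite sums of $\theta_{\eta,\varphi}(\xi)=\eta\varphi(\xi)$ (action $T\mapsto S_gTS_{g^{-1}}$); $\mathcal L_A(\mathcal E)$ the $V\in\mathrm{Hom}_A(\mathcal E)$ with $\varphi\circ V\in\Theta_A(\mathcal E)$ for all $\varphi$. $\mathcal E$ is cofull if each element is a finite sum of $\xi\varphi(\eta)$; modules underlying rings of compact operators are assumed cofull. A quadratik ring is a functional module over itself with functionals the left multiplications; direct sums have diagonal structure. Internal tensor product: for right functional modules $\mathcal E$ over $C$, $\mathcal F$ over $D$ and a ring homomorphism $\pi\colon C\to\mathcal L_D(\mathcal F)$, $\mathcal E\otimes_\pi\mathcal F$ is $\mathcal E\otimes_{\mathbb Z}\mathcal F$ modulo all $\sum\xi_i\otimes\eta_i$ with $\sum\pi(\varphi(\xi_i))\eta_i=0$ for all $\varphi\in\Theta_C(\mathcal E)$, a right functional $D$-module with diagonal action and functionals the sums of $\varphi\otimes\psi\colon\xi\otimes\eta\mapsto\psi(\pi(\varphi(\xi))\eta)$.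 An isomorphism of right functional modules is a pair $(X,f)$ of bijective equivariant maps, $X$ a right module map and $f$ a left module map between the functional spaces, with $f(\varphi)(X(\xi))=\varphi(\xi)$. Functional Morita equivalence: $A$ and $B$ are functional Morita equivalent if there are a right functional $B$-module $\mathcal E$, a right functional $A$-module $\mathcal F$ and ring homomorphisms $m\colon A\to\mathcal K_B(\mathcal E)$, $n\colon B\to\mathcal K_A(\mathcal F)$ (making $\mathcal E,\mathcal F$ bimodules) such that $\mathcal E\otimes_n\mathcal F\cong A$ as right functional, left ordinary $A$-$A$-bimodules and $\mathcal F\otimes_m\mathcal E\cong B$ as right functional, left ordinary $B$-$B$-bimodules. Corner embedding: $e\colon A\to\mathcal K_A(\mathcal E\oplus\mathcal H_A)$, $e(a)(\xi\oplus b\oplus\eta)=0\oplus ab\oplus0$, where $\mathcal H_A=\bigoplus_{i\in I}A$ ($I\neq\emptyset$) has action $\alpha\oplus T$ with a distinguished copy carrying $\alpha$ and $\mathcal E\oplus\mathcal H_A$ is cofull (also up to isomorphism). $GK^G$: objects the $G$-equivariant quadratik rings of a fixed set-sized class closed under the constructions used; morphisms generated by ring homomorphisms, formal inverses $e^{-1}$ of corner embeddings, and $\Delta_s\colon M\to B$ for split exact sequences $0\to B\xrightarrow{j}M\xrightarrow{f}A\to0$ with equivariant split $s$, with free addition, modulo: composition, identities, $1_{A\oplus B}=p_Ai_A+p_Bi_B$, equality of homotopic homomorphisms (homotopies $A\to B\otimes_{\mathbb Z}C([0,1],\mathbb C)$ with endpoint values in $B\otimes\mathbb Z\cong B$), $e^{-1}$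 inverse to $e$, $j\Delta_s=1_B$, $\Delta_sj+fs=1_M$. *)

(* Defs.v *)
(* Everything (groups, non-unital G-rings, functional modules, compact        *)
(* operators, internal tensor products, corner embeddings, split exact        *)
(* sequences, homotopies and the category GK^G) is built from raw data with   *)
(* explicit axioms; carriers of derived constructions are subtypes/quotients  *)
(* whose operations are defined with Hilbert's epsilon (choice of             *)
(* representatives), which is well defined by the corresponding closure /     *)
(* well-definedness facts.                                                    *)
From Stdlib Require Import Reals List ClassicalEpsilon.
From Coquelicot Require Import Coquelicot.
Import ListNotations.

Set Implicit Arguments.
Unset Strict Implicit.

Definition lsum {T : Type} (add : T -> T -> T) (z : T) (l : list T) : T :=
  fold_right add z l.

Definition mk {T : Type} {P : T -> Prop} (d : sig P) (v : T) : sig P :=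
  epsilon (inhabits d) (fun z => proj1_sig z = v).

Definition bij {X Y : Type} (f : X -> Y) : Prop :=
  exists g : Y -> X, (forall x, g (f x) = x) /\ (forall y, f (g y) = y).

Record group : Type := Group {
  gcar :> Type;
  gmul : gcar -> gcar -> gcar;
  gone : gcar;
  ginv : gcar -> gcar;
  gmulA : forall x y z, gmul x (gmul y z) = gmul (gmul x y) z;
  gmul1 : forall x, gmul gone x = x;
  gmulV : forall x, gmul (ginv x) x = gone }.
Arguments gmul : clear implicits. Arguments gone : clear implicits.
Arguments ginv : clear implicits.

Section Rings.
Variable G : group.

Record rdata : Type := RData {
  car :> Type;
  radd : car -> car -> car;
  ropp : car -> car;
  rzero : car;
  rmul : car -> car -> car;
  ract : G -> car -> car }.
Arguments radd : clear implicits. Arguments ropp : clear implicits.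
Arguments rzero : clear implicits. Arguments rmul : clear implicits.
Arguments ract : clear implicits.

Definition is_ring (R : rdata) : Prop :=
  (forall x y z, radd R x (radd R y z) = radd R (radd R x y) z) /\
  (forall x y, radd R x y = radd R y x) /\
  (forall x, radd R (rzero R) x = x) /\
  (forall x, radd R (ropp R x) x = rzero R) /\
  (forall x y z, rmul R x (rmul R y z) = rmul R (rmul R x y) z) /\
  (forall x y z, rmul R x (radd R y z) = radd R (rmul R x y) (rmul R x z)) /\
  (forall x y z, rmul R (radd R x y) z = radd R (rmul R x z) (rmul R y z)) /\
  (forall g x y, ract R g (radd R x y) = radd R (ract R g x) (ract R g y)) /\
  (forall g x y, ract R g (rmul R x y) = rmul R (ract R g x) (ract R g y)) /\
  (forall x, ract R (gone G) x = x) /\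
  (forall g h x, ract R (gmul G g h) x = ract R g (ract R h x)).

Definition quadratik (R : rdata) : Prop :=
  forall x : R, exists l : list (R * R),
    x = lsum (radd R) (rzero R) (map (fun p => rmul R (fst p) (snd p)) l).

Definition is_obj (R : rdata) : Prop := is_ring R /\ quadratik R.

Definition is_hom (A B : rdata) (f : A -> B) : Prop :=
  (forall x y, f (radd A x y) = radd B (f x) (f y)) /\
  (forall x y, f (rmul A x y) = rmul B (f x) (f y)) /\
  (forall g x, f (ract A g x) = ract B g (f x)).

Arguments is_hom : clear implicits.

Record fmod (A : rdata) : Type := FMod {
  mcar :> Type;
  madd : mcar -> mcar -> mcar;
  mopp : mcar -> mcar;
  mzero : mcar;
  mrac : mcar -> A -> mcar;
  mS : G -> mcar -> mcar;
  mtheta : (mcar -> A) -> Prop }.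
Arguments madd {A} f _ _. Arguments mopp {A} f _.
Arguments mzero {A} f. Arguments mrac {A} f _ _.
Arguments mS {A} f _ _. Arguments mtheta {A} f _.

Section FMod.
Variable A : rdata.

Definition Th (E : fmod A) : Type := { phi : E -> A | mtheta E phi }.

Definition thact (E : fmod A) (g : G) (phi : E -> A) : E -> A :=
  fun xi => ract A g (phi (mS E (ginv G g) xi)).

Definition is_fmod (E : fmod A) : Prop :=
  (forall x y z, madd E x (madd E y z) = madd E (madd E x y) z) /\
  (forall x y, madd E x y = madd E y x) /\
  (forall x, madd E (mzero E) x = x) /\
  (forall x, madd E (mopp E x) x = mzero E) /\
  (forall x y a, mrac E (madd E x y) a = madd E (mrac E x a) (mrac E y a)) /\
  (forall x a b, mrac E x (radd A a b) = madd E (mrac E x a) (mrac E x b)) /\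
  (forall x a b, mrac E x (rmul A a b) = mrac E (mrac E x a) b) /\
  (forall g x y, mS E g (madd E x y) = madd E (mS E g x) (mS E g y)) /\
  (forall x, mS E (gone G) x = x) /\
  (forall g h x, mS E (gmul G g h) x = mS E g (mS E h x)) /\
  (forall g x a, mS E g (mrac E x a) = mrac E (mS E g x) (ract A g a)) /\
  (forall phi, mtheta E phi ->
     (forall x y, phi (madd E x y) = radd A (phi x) (phi y)) /\
     (forall x a, phi (mrac E x a) = rmul A (phi x) a)) /\
  mtheta E (fun _ => rzero A) /\
  (forall phi psi, mtheta E phi -> mtheta E psi ->
     mtheta E (fun x => radd A (phi x) (psi x))) /\
  (forall a phi, mtheta E phi -> mtheta E (fun x => rmul A a (phi x))) /\
  (forall g phi, mtheta E phi -> mtheta E (thact g phi)).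

Definition cofull (E : fmod A) : Prop :=
  forall x : E, exists l : list (E * E * Th E),
    x = lsum (madd E) (mzero E)
          (map (fun p => mrac E (fst (fst p)) (proj1_sig (snd p) (snd (fst p)))) l).

Definition Aself : fmod A :=
  @FMod A (car A) (radd A) (ropp A) (rzero A) (rmul A) (ract A)
    (fun f => exists a : A, f = fun x => rmul A a x).

Definition isK (E : fmod A) (T : E -> E) : Prop :=
  exists l : list (E * Th E),
    T = fun xi => lsum (madd E) (mzero E)
                    (map (fun p => mrac E (fst p) (proj1_sig (snd p) xi)) l).

Arguments isK : clear implicits.

Definition Kcar (E : fmod A) : Type := { T : E -> E | isK E T }.

Definition K0 (E : fmod A) : Kcar E :=
  exist (isK E) (fun _ => mzero E) (ex_intro _ nil eq_refl).

Definition Kring (E : fmod A) : rdata :=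
  @RData (Kcar E)
    (fun S T => mk (K0 E) (fun xi => madd E (proj1_sig S xi) (proj1_sig T xi)))
    (fun S => mk (K0 E) (fun xi => mopp E (proj1_sig S xi)))
    (K0 E)
    (fun S T => mk (K0 E) (fun xi => proj1_sig S (proj1_sig T xi)))
    (fun g T => mk (K0 E) (fun xi => mS E g (proj1_sig T (mS E (ginv G g) xi)))).

Definition fiso (E F : fmod A) (X : E -> F) (f : Th E -> Th F) : Prop :=
  bij X /\
  (forall x y, X (madd E x y) = madd F (X x) (X y)) /\
  (forall x a, X (mrac E x a) = mrac F (X x) a) /\
  (forall g x, X (mS E g x) = mS F g (X x)) /\
  bij f /\
  (forall phi psi chi : Th E,
     proj1_sig chi = (fun x => radd A (proj1_sig phi x) (proj1_sig psi x)) ->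
     proj1_sig (f chi) = (fun y => radd A (proj1_sig (f phi) y) (proj1_sig (f psi) y))) /\
  (forall a (phi chi : Th E),
     proj1_sig chi = (fun x => rmul A a (proj1_sig phi x)) ->
     proj1_sig (f chi) = (fun y => rmul A a (proj1_sig (f phi) y))) /\
  (forall g (phi chi : Th E),
     proj1_sig chi = thact g (proj1_sig phi) ->
     proj1_sig (f chi) = thact g (proj1_sig (f phi))) /\
  (forall (phi : Th E) x, proj1_sig (f phi) (X x) = proj1_sig phi x).

Definition fiso_bi (A' : rdata) (E F : fmod A) (lE : A' -> E -> E)
  (lF : A' -> F -> F) (X : E -> F) (f : Th E -> Th F) : Prop :=
  fiso X f /\ (forall a x, X (lE a x) = lF a (X x)).

End FMod.

Section Tensor.
Variables (C D : rdata) (E : fmod C) (F : fmod D) (pi : C -> F -> F).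

(* the element sum_i xi_i (x) eta_i, seen through all phi in Theta_C(E):
   E (x)_Z F modulo the given submodule is identified with the image of this
   map (quotient by its kernel) *)
Definition tev (l : list (E * F)) : Th E -> F :=
  fun phi => lsum (madd F) (mzero F)
               (map (fun p => pi (proj1_sig phi (fst p)) (snd p)) l).

Definition tcar : Type := { x : Th E -> F | exists l, x = tev l }.

Definition tcls (l : list (E * F)) : tcar := exist _ (tev l) (ex_intro _ l eq_refl).

Definition trep (x : tcar) : list (E * F) :=
  epsilon (inhabits nil) (fun l => proj1_sig x = tev l).

Definition tensor : fmod D :=
  @FMod D tcar
    (fun x y => tcls (trep x ++ trep y))
    (fun x => tcls (map (fun p => (mopp E (fst p), snd p)) (trep x)))
    (tcls nil)
    (fun x d => tcls (map (fun p => (fst p, mrac F (snd p) d)) (trep x)))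
    (fun g x => tcls (map (fun p => (mS E g (fst p), mS F g (snd p))) (trep x)))
    (fun f => exists l : list (Th E * Th F),
       f = fun x => lsum (radd D) (rzero D)
             (map (fun q => lsum (radd D) (rzero D)
                     (map (fun p => proj1_sig (snd q)
                                      (pi (proj1_sig (fst q) (fst p)) (snd p)))
                          (trep x))) l)).

Definition tlact (A' : rdata) (lam : A' -> E -> E) (a : A') (x : tcar) : tcar :=
  tcls (map (fun p => (lam a (fst p), snd p)) (trep x)).

End Tensor.

Definition morita (A B : rdata) : Prop :=
  exists (E : fmod B) (F : fmod A) (m : A -> Kring E) (n : B -> Kring F),
    is_fmod E /\ is_fmod F /\ cofull E /\ cofull F /\
    is_hom A (Kring E) m /\ is_hom B (Kring F) n /\
    (exists (X : tensor E (fun b => proj1_sig (n b)) -> Aself A)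
            (f : Th (tensor E (fun b => proj1_sig (n b))) -> Th (Aself A)),
       @fiso_bi A A (tensor E (fun b => proj1_sig (n b))) (Aself A) (@tlact B A E F (fun b => proj1_sig (n b)) A (fun a xi => proj1_sig (m a) xi))
               (fun a x => rmul A a x) X f) /\
    (exists (X : tensor F (fun a => proj1_sig (m a)) -> Aself B)
            (f : Th (tensor F (fun a => proj1_sig (m a))) -> Th (Aself B)),
       @fiso_bi B B (tensor F (fun a => proj1_sig (m a))) (Aself B) (@tlact A B F E (fun a => proj1_sig (m a)) B (fun b eta => proj1_sig (n b) eta))
               (fun b x => rmul B b x) X f).

Section Corner.
Variable A : rdata.

Definition Hcar (I : Type) : Type :=
  { h : I -> A | exists l : list I, forall i, ~ In i l -> h i = rzero A }.

Definition H0 (I : Type) : Hcar I :=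
  exist _ (fun _ => rzero A) (ex_intro _ nil (fun i _ => eq_refl)).

Definition Hmod (I : Type) (V : G -> Hcar I -> Hcar I) : fmod A :=
  @FMod A (Hcar I)
    (fun h k => mk (H0 I) (fun i => radd A (proj1_sig h i) (proj1_sig k i)))
    (fun h => mk (H0 I) (fun i => ropp A (proj1_sig h i)))
    (H0 I)
    (fun h a => mk (H0 I) (fun i => rmul A (proj1_sig h i) a))
    V
    (fun f => exists l : list (I * A),
       f = fun h => lsum (radd A) (rzero A)
             (map (fun p => rmul A (snd p) (proj1_sig h (fst p))) l)).

Definition Esum (E H : fmod A) : fmod A :=
  @FMod A (E * H)%type
    (fun x y => (madd E (fst x) (fst y), madd H (snd x) (snd y)))
    (fun x => (mopp E (fst x), mopp H (snd x)))
    (mzero E, mzero H)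
    (fun x a => (mrac E (fst x) a, mrac H (snd x) a))
    (fun g x => (mS E g (fst x), mS H g (snd x)))
    (fun f => exists phi psi, mtheta E phi /\ mtheta H psi /\
                f = fun x => radd A (phi (fst x)) (psi (snd x))).

Record corner : Type := Corner {
  cE : fmod A;
  cI : Type;
  ci0 : cI;                                  (* distinguished copy; I <> empty *)
  cV : G -> Hcar cI -> Hcar cI;              (* the action alpha (+) T on H_A *)
  cX : fmod A;
  cU : cX -> Esum cE (Hmod cV);
  cu : Th cX -> Th (Esum cE (Hmod cV)) }.
Arguments cV : clear implicits. Arguments cU : clear implicits.
Arguments cu : clear implicits.

Definition corner_valid (c : corner) : Prop :=
  is_fmod (cE c) /\ is_fmod (Hmod (cV c)) /\
  (forall g h, proj1_sig (cV c g h) (ci0 c) = ract A g (proj1_sig h (ci0 c))) /\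
  (* the other copies carry an action T independent of the distinguished one *)
  (forall g (h h' : Hcar (cI c)),
     (forall i, i <> ci0 c -> proj1_sig h i = proj1_sig h' i) ->
     forall i, i <> ci0 c -> proj1_sig (cV c g h) i = proj1_sig (cV c g h') i) /\
  is_fmod (cX c) /\ fiso (cU c) (cu c) /\ cofull (cX c).

Definition e0 (c : corner) (a : A) (x : Esum (cE c) (Hmod (cV c)))
  : Esum (cE c) (Hmod (cV c)) :=
  (mzero (cE c),
   mk (H0 (cI c)) (fun i => if excluded_middle_informative (i = ci0 c)
                           then rmul A a (proj1_sig (snd x) (ci0 c))
                           else rzero A)).

Arguments e0 : clear implicits.

Definition ecorner (c : corner) (a : A) : Kring (cX c) :=
  mk (K0 (cX c)) (fun xi => epsilon (inhabits xi)
                             (fun zeta => cU c zeta = e0 c a (cU c xi))).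

End Corner.

Definition split_valid (B M A : rdata) (j : B -> M) (f : M -> A) (s : A -> M) : Prop :=
  is_hom B M j /\ is_hom M A f /\ is_hom A M s /\
  (forall x y, j x = j y -> x = y) /\
  (forall a, exists m, f m = a) /\
  (forall m, f m = rzero A <-> exists b, j b = m) /\
  (forall a, f (s a) = a).

Definition Rsum (A B : rdata) : rdata :=
  @RData (A * B)%type
    (fun x y => (radd A (fst x) (fst y), radd B (snd x) (snd y)))
    (fun x => (ropp A (fst x), ropp B (snd x)))
    (rzero A, rzero B)
    (fun x y => (rmul A (fst x) (fst y), rmul B (snd x) (snd y)))
    (fun g x => (ract A g (fst x), ract B g (snd x))).

(* ---------- Z-tensor product B (x)_Z P, P a subgroup of (M, madd) ---------- *)

Section ZTensor.
Variables (B : rdata) (M : Type) (madd' mmul : M -> M -> M) (P : M -> Prop).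

Inductive tens_rel : list (B * M)%type -> list (B * M)%type -> Prop :=
| tr_refl l : tens_rel l l
| tr_sym l l' : tens_rel l l' -> tens_rel l' l
| tr_trans l1 l2 l3 : tens_rel l1 l2 -> tens_rel l2 l3 -> tens_rel l1 l3
| tr_app l1 l1' l2 l2' : tens_rel l1 l1' -> tens_rel l2 l2' ->
    tens_rel (l1 ++ l2) (l1' ++ l2')
| tr_swap l1 l2 : tens_rel (l1 ++ l2) (l2 ++ l1)
| tr_addl b b' m : P m -> tens_rel [(radd B b b', m)] [(b, m); (b', m)]
| tr_addr b m m' : P m -> P m' -> tens_rel [(b, madd' m m')] [(b, m); (b, m')]
| tr_zero m : P m -> tens_rel [(rzero B, m)] nil.

Definition ztcar : Type :=
  { c : list (B * M)%type -> Prop |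
    exists l, List.Forall (fun p => P (snd p)) l /\ c = tens_rel l }.

Definition zt0 : ztcar :=
  exist _ (tens_rel nil) (ex_intro _ nil (conj (List.Forall_nil _) eq_refl)).

Definition ztcls (l : list (B * M)%type) : ztcar := mk zt0 (tens_rel l).

Definition ztrep (x : ztcar) : list (B * M)%type :=
  epsilon (inhabits nil)
    (fun l => List.Forall (fun p => P (snd p)) l /\ proj1_sig x = tens_rel l).

Definition ZTens : rdata :=
  @RData ztcar
    (fun x y => ztcls (ztrep x ++ ztrep y))
    (fun x => ztcls (map (fun p => (ropp B (fst p), snd p)) (ztrep x)))
    zt0
    (fun x y => ztcls (flat_map (fun p => map (fun q => (rmul B (fst p) (fst q),
                                                      mmul (snd p) (snd q)))
                                          (ztrep y)) (ztrep x)))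
    (fun g x => ztcls (map (fun p => (ract B g (fst p), snd p)) (ztrep x))).

End ZTensor.
Arguments ztcls : clear implicits. Arguments ztrep : clear implicits.
Arguments ZTens : clear implicits.

Definition I01 : Type := { t : R | 0 <= t <= 1 }.
Definition t0 : I01 := exist _ 0 (conj (Rle_refl 0) Rle_0_1).
Definition t1 : I01 := exist _ 1 (conj Rle_0_1 (Rle_refl 1)).

Definition cont01 (f : I01 -> C) : Prop :=
  forall (t : I01) (eps : R), 0 < eps -> exists del : R, 0 < del /\
    forall s : I01, Rabs (proj1_sig s - proj1_sig t) < del ->
      Cmod (Cminus (f s) (f t)) < eps.

Definition BC (B : rdata) : rdata :=
  ZTens B (I01 -> C) (fun f g t => Cplus (f t) (g t)) (fun f g t => Cmult (f t) (g t)) cont01.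

Definition BCc (B : rdata) : rdata :=
  ZTens B C Cplus Cmult (fun _ => True).

Definition evalt (B : rdata) (t : I01) (x : BC B) : BCc B :=
  ztcls B C Cplus (fun _ => True)
    (map (fun p => (fst p, snd p t)) (ztrep B (I01 -> C) (fun f g t => Cplus (f t) (g t)) cont01 x)).

(* B = B (x)_Z Z -> B (x)_Z C *)
Definition iotaC (B : rdata) (b : B) : BCc B :=
  ztcls B C Cplus (fun _ => True) [(b, RtoC 1)].

Definition homotopic (A B : rdata) (f0 f1 : A -> B) : Prop :=
  exists H : A -> BC B, is_hom A (BC B) H /\
    (forall a, evalt t0 (H a) = iotaC (f0 a)) /\
    (forall a, evalt t1 (H a) = iotaC (f1 a)).

Definition Obj : Type := { R : rdata | is_obj R }.
Definition ocar (X : Obj) : rdata := proj1_sig X.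

Definition Kobj (A : rdata) (c : corner A) (HK : is_obj (Kring (cX c))) : Obj :=
  exist is_obj (Kring (cX c)) HK.
Definition Sobj (A B : Obj) (H : is_obj (Rsum (ocar A) (ocar B))) : Obj :=
  exist is_obj (Rsum (ocar A) (ocar B)) H.

(* morphisms: formal expressions (composition written left-to-right: x;y
   means first x then y, as in the relations  j Delta_s = 1_B) *)
Inductive term : Obj -> Obj -> Type :=
| tId (A : Obj) : term A A
| tHom (A B : Obj) (f : ocar A -> ocar B) : is_hom (ocar A) (ocar B) f -> term A B
| tEinv (A : Obj) (c : corner (ocar A)) : corner_valid c ->
    forall HK : is_obj (Kring (cX c)), term (Kobj HK) A
| tDelta (B M A : Obj) (j : ocar B -> ocar M) (f : ocar M -> ocar A)
    (s : ocar A -> ocar M) : split_valid j f s -> term M B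
| tComp (A B C : Obj) : term A B -> term B C -> term A C
| tAdd (A B : Obj) : term A B -> term A B -> term A B.

Arguments tId : clear implicits.
Arguments tHom {A B} f _.

Inductive gk_eq : forall A B : Obj, term A B -> term A B -> Prop :=
| ge_refl A B (x : term A B) : gk_eq x x
| ge_sym A B (x y : term A B) : gk_eq x y -> gk_eq y x
| ge_trans A B (x y z : term A B) : gk_eq x y -> gk_eq y z -> gk_eq x z
| ge_comp A B C (x x' : term A B) (y y' : term B C) :
    gk_eq x x' -> gk_eq y y' -> gk_eq (tComp x y) (tComp x' y')
| ge_add A B (x x' y y' : term A B) :
    gk_eq x x' -> gk_eq y y' -> gk_eq (tAdd x y) (tAdd x' y')
| ge_addC A B (x y : term A B) : gk_eq (tAdd x y) (tAdd y x)
| ge_addA A B (x y z : term A B) : gk_eq (tAdd x (tAdd y z)) (tAdd (tAdd x y) z)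
| ge_distl A B C (x y : term A B) (z : term B C) :
    gk_eq (tComp (tAdd x y) z) (tAdd (tComp x z) (tComp y z))
| ge_distr A B C (z : term A B) (x y : term B C) :
    gk_eq (tComp z (tAdd x y)) (tAdd (tComp z x) (tComp z y))
| ge_compA A B C D (x : term A B) (y : term B C) (z : term C D) :
    gk_eq (tComp x (tComp y z)) (tComp (tComp x y) z)
| ge_idl A B (x : term A B) : gk_eq (tComp (tId A) x) x
| ge_idr A B (x : term A B) : gk_eq (tComp x (tId B)) x
| ge_homcomp A B C (f : ocar A -> ocar B) (g : ocar B -> ocar C) Hf Hg Hgf :
    gk_eq (tComp (tHom f Hf) (tHom g Hg)) (tHom (fun x => g (f x)) Hgf)
| ge_homid A H : gk_eq (@tHom A A (fun x => x) H) (tId A)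
| ge_sum (A B : Obj) (HS : is_obj (Rsum (ocar A) (ocar B))) HpA HiA HpB HiB :
    gk_eq (tId (Sobj HS))
      (tAdd (tComp (@tHom (Sobj HS) A fst HpA)
                   (@tHom A (Sobj HS) (fun a => (a, rzero (ocar B))) HiA))
            (tComp (@tHom (Sobj HS) B snd HpB)
                   (@tHom B (Sobj HS) (fun b => (rzero (ocar A), b)) HiB)))
| ge_homotopy A B (f0 f1 : ocar A -> ocar B) H0 H1 :
    homotopic f0 f1 -> gk_eq (tHom f0 H0) (tHom f1 H1)
| ge_corner1 (A : Obj) (c : corner (ocar A)) Hc HK He :
    gk_eq (tComp (@tHom A (Kobj HK) (ecorner c) He) (tEinv Hc HK)) (tId A)
| ge_corner2 (A : Obj) (c : corner (ocar A)) Hc HK He :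
    gk_eq (tComp (tEinv Hc HK) (@tHom A (Kobj HK) (ecorner c) He)) (tId (Kobj HK))
| ge_split1 (B M A : Obj) (j : ocar B -> ocar M) (f : ocar M -> ocar A)
    (s : ocar A -> ocar M) (Hs : split_valid j f s) Hj :
    gk_eq (tComp (@tHom B M j Hj) (tDelta Hs)) (tId B)
| ge_split2 (B M A : Obj) (j : ocar B -> ocar M) (f : ocar M -> ocar A)
    (s : ocar A -> ocar M) (Hs : split_valid j f s) Hj Hf Hs' :
    gk_eq (tAdd (tComp (tDelta Hs) (@tHom B M j Hj))
                (tComp (@tHom M A f Hf) (@tHom A M s Hs'))) (tId M).

Definition gk_iso (A B : Obj) : Prop :=
  exists (x : term A B) (y : term B A),
    gk_eq (tComp x y) (tId A) /\ gk_eq (tComp y x) (tId B).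

End Rings.

(* Main.v *)
(** For a homomorphism [n : B -> K_A(F)] and a cofull [X], every compact operator [S] of [X] induces the
compact operator [S (x) 1] of [X (x)_n F], so [b |-> b (x) 1] makes sense on all of [K_B(E (+) B)].  The morphism
[A -> B] is [m], seen in a corner of [K_B(E (+) B)], followed by the inverse of the corner embedding of [B];
[B -> A] is defined in the same way from [n].  All maps needed to compose them live in
[K_A(F (+) ((E (+) B) (x)_n F) (+) A)].  There, [n] on [F] is homotopic to [b |-> e(b) (x) 1], although [F] and
[B (x)_n F] need not be isomorphic: the off-diagonal entries [eta |-> b (x) eta] and [b' (x) eta |-> n(b b') eta]
complete the two maps to a homomorphism from [M_2(B)], and in [M_2] the diagonal matrix units are homotopic.
In the same way [m (x) 1] is homotopic to the corner embedding of [A], as [E (x)_n F] is isomorphic to [A].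
Hence the composite [A -> B -> A] is the identity, and the other composite follows by symmetry. *)
Require Import Defs.
From Stdlib Require Import Reals List ClassicalEpsilon.
From Stdlib Require Import FunctionalExtensionality PropExtensionality ProofIrrelevance.
From Stdlib Require Import Permutation Lra Setoid Morphisms.
From Coquelicot Require Import Coquelicot.
Import ListNotations.

(** * Groups, rings and modules *)

(* The inverse of a corner embedding [e] is only formal, so a word [e^{-1}; y] can be simplified
   only by extending [y] along [e], here up to homotopy and after enlarging the target. This is why
   [S (x) 1] has to make sense on the whole target of [e]. A homotopy is used because [B (x)_n F] is
   the quotient of the additive span of the [n(b) y] by the elements that [n(B)] kills, and so may
   lose a part of [F]. The rings need not have units; therefore the homotopy is not a conjugation by
   rotation matrices but a polynomial path of idempotent matrices with integer coefficients,
   multiplied with ring elements. The recurring difficulty is compactness: maps such as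
   [y |-> x (x) y] or [z |-> z(phi)] are not visibly finite sums of [theta]s. It is gained by
   splitting off a factor: a ring element is a sum of products, a vector of a cofull module is a sum
   of [x phi(x')], and a factor moved across the tensor sign becomes some [n(b)], which is compact
   by hypothesis. *)
Existing Class is_ring.
Existing Class is_fmod.

Lemma sig_ext {T : Type} {P : T -> Prop} (x y : sig P) : proj1_sig x = proj1_sig y -> x = y.
Proof. destruct x as [x Hx], y as [y Hy]; simpl; intros <-. f_equal. apply proof_irrelevance. Qed.

(** Operations built with [mk] carry no closure proof; their values become computable only once
    closure is proved, and this lemma is where that happens. *)
Lemma mkE {T : Type} {P : T -> Prop} (d : sig P) (v : T) : P v -> proj1_sig (mk d v) = v.
Proof.
  intros Hv. unfold mk.
  apply (epsilon_spec (inhabits d) (fun z => proj1_sig z = v)).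
  now exists (exist P v Hv).
Qed.

Ltac pick_axiom H := unfold is_ring, is_fmod in H; decompose [and] H; auto.

Section Group.
Context {G : group}.
Lemma gmulVr (x : G) : gmul G x (ginv G x) = gone G.
Proof.
  pose (y := ginv G x). fold y.
  rewrite <- (gmul1 (gmul G x y)), <- (gmulV y), <- gmulA, (gmulA y x y).
  assert (H : gmul G y x = gone G) by apply gmulV. now rewrite H, gmul1.
Qed.

Lemma gmul1r (x : G) : gmul G x (gone G) = x.
Proof. now rewrite <- (gmulV x), gmulA, gmulVr, gmul1. Qed.

Lemma ginv_unique (x y : G) : gmul G x y = gone G -> y = ginv G x.
Proof. intros H. now rewrite <- (gmul1 y), <- (gmulV x), <- gmulA, H, gmul1r. Qed.

Lemma ginvM (x y : G) : ginv G (gmul G x y) = gmul G (ginv G y) (ginv G x).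
Proof.
  symmetry. apply ginv_unique.
  now rewrite gmulA, <- (gmulA x), gmulVr, gmul1r, gmulVr.
Qed.

Lemma ginv1 : ginv G (gone G) = gone G.
Proof. symmetry. apply ginv_unique. apply gmul1. Qed.
End Group.

Section Ring.
Context {G : group} {R : rdata G} {HR : is_ring R}.
Implicit Types x y z : R.
Lemma raddA x y z : radd x (radd y z) = radd (radd x y) z. Proof. pick_axiom HR. Qed.
Lemma raddC x y : radd x y = radd y x. Proof. pick_axiom HR. Qed.
Lemma radd0l x : radd (rzero R) x = x. Proof. pick_axiom HR. Qed.
Lemma raddNl x : radd (ropp x) x = rzero R. Proof. pick_axiom HR. Qed.
Lemma rmulA x y z : rmul x (rmul y z) = rmul (rmul x y) z. Proof. pick_axiom HR. Qed.
Lemma rmulDr x y z : rmul x (radd y z) = radd (rmul x y) (rmul x z). Proof. pick_axiom HR. Qed.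
Lemma rmulDl x y z : rmul (radd x y) z = radd (rmul x z) (rmul y z). Proof. pick_axiom HR. Qed.
Lemma ractD g x y : ract g (radd x y) = radd (ract g x) (ract g y). Proof. pick_axiom HR. Qed.
Lemma ractM g x y : ract g (rmul x y) = rmul (ract g x) (ract g y). Proof. pick_axiom HR. Qed.
Lemma ract1 x : ract (gone G) x = x. Proof. pick_axiom HR. Qed.
Lemma ractG g h x : ract (gmul G g h) x = ract g (ract h x). Proof. pick_axiom HR. Qed.

Lemma radd0r x : radd x (rzero R) = x.
Proof. now rewrite raddC, radd0l. Qed.
(** Homomorphisms and functionals are only required to be additive; that they preserve zero follows
    because they send it to an additive idempotent. *)
Lemma radd_idem x : radd x x = x -> x = rzero R.
Proof. intros H. transitivity (radd (ropp x) (radd x x)); [now rewrite raddA, raddNl, radd0l|now rewrite H, raddNl]. Qed.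
Lemma rmul0r x : rmul x (rzero R) = rzero R.
Proof. apply radd_idem. now rewrite <- rmulDr, radd0l. Qed.
Lemma rmul0l x : rmul (rzero R) x = rzero R.
Proof. apply radd_idem. now rewrite <- rmulDl, radd0l. Qed.
Lemma ract0 g : ract g (rzero R) = rzero R.
Proof. apply radd_idem. now rewrite <- ractD, radd0l. Qed.
Lemma ractK g x : ract g (ract (ginv G g) x) = x.
Proof. now rewrite <- ractG, gmulVr, ract1. Qed.
Lemma raddACA x y z t : radd (radd x y) (radd z t) = radd (radd x z) (radd y t).
Proof. rewrite !raddA. f_equal. rewrite <- !raddA. f_equal. apply raddC. Qed.
End Ring.

Section Fmod.
Context {G : group} {A : rdata G} {E : fmod A} {HE : is_fmod E}.
Implicit Types x y z : E.
Lemma maddA x y z : madd x (madd y z) = madd (madd x y) z. Proof. pick_axiom HE. Qed.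
Lemma maddC x y : madd x y = madd y x. Proof. pick_axiom HE. Qed.
Lemma madd0l x : madd (mzero E) x = x. Proof. pick_axiom HE. Qed.
Lemma maddNl x : madd (mopp x) x = mzero E. Proof. pick_axiom HE. Qed.
Lemma mracDl x y a : mrac (madd x y) a = madd (mrac x a) (mrac y a). Proof. pick_axiom HE. Qed.
Lemma mracDr x a b : mrac x (radd a b) = madd (mrac x a) (mrac x b). Proof. pick_axiom HE. Qed.
Lemma mracA x a b : mrac x (rmul a b) = mrac (mrac x a) b. Proof. pick_axiom HE. Qed.
Lemma mSD g x y : mS g (madd x y) = madd (mS g x) (mS g y). Proof. pick_axiom HE. Qed.
Lemma mS1 x : mS (gone G) x = x. Proof. pick_axiom HE. Qed.
Lemma mSG g h x : mS (gmul G g h) x = mS g (mS h x). Proof. pick_axiom HE. Qed.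
Lemma mSrac g x a : mS g (mrac x a) = mrac (mS g x) (ract g a). Proof. pick_axiom HE. Qed.
Lemma mthD (phi : E -> A) (H : mtheta phi) x y : phi (madd x y) = radd (phi x) (phi y).
Proof. destruct HE as (_&_&_&_&_&_&_&_&_&_&_&K&_). now apply K. Qed.
Lemma mthZ (phi : E -> A) (H : mtheta phi) x a : phi (mrac x a) = rmul (phi x) a.
Proof. destruct HE as (_&_&_&_&_&_&_&_&_&_&_&K&_). now apply K. Qed.
Lemma mth0 : mtheta (fun _ : E => rzero A). Proof. pick_axiom HE. Qed.
Lemma mth_add (phi psi : E -> A) : mtheta phi -> mtheta psi -> mtheta (fun x => radd (phi x) (psi x)).
Proof. pick_axiom HE. Qed.
Lemma mth_mul a (phi : E -> A) : mtheta phi -> mtheta (fun x => rmul a (phi x)).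
Proof. pick_axiom HE. Qed.
Lemma mth_act g (phi : E -> A) : mtheta phi -> mtheta (thact g phi). Proof. pick_axiom HE. Qed.

Lemma madd0r x : madd x (mzero E) = x.
Proof. now rewrite maddC, madd0l. Qed.
Lemma madd_idem x : madd x x = x -> x = mzero E.
Proof. intros H. transitivity (madd (mopp x) (madd x x)); [now rewrite maddA, maddNl, madd0l|now rewrite H, maddNl]. Qed.
Lemma mrac0l a : mrac (mzero E) a = mzero E.
Proof. apply madd_idem. now rewrite <- mracDl, madd0l. Qed.
Lemma mS0 g : mS g (mzero E) = mzero E.
Proof. apply madd_idem. now rewrite <- mSD, madd0l. Qed.
Lemma mSK g x : mS g (mS (ginv G g) x) = x.
Proof. now rewrite <- mSG, gmulVr, mS1. Qed.
Lemma mSVK g x : mS (ginv G g) (mS g x) = x.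
Proof. now rewrite <- mSG, gmulV, mS1. Qed.
Lemma mth_zero {HA : is_ring A} (phi : E -> A) : mtheta phi -> phi (mzero E) = rzero A.
Proof. intros H. apply radd_idem. now rewrite <- (mthD _ H), madd0l. Qed.
Lemma maddACA x y z t : madd (madd x y) (madd z t) = madd (madd x z) (madd y t).
Proof. rewrite !maddA. f_equal. rewrite <- !maddA. f_equal. apply maddC. Qed.
Lemma mopp_unique x y : madd x y = mzero E -> x = mopp y.
Proof.
  intros H. rewrite <- (madd0r x), <- (maddNl y), (maddC (mopp y)), maddA, H. apply madd0l.
Qed.
Lemma moppD x y : mopp (madd x y) = madd (mopp x) (mopp y).
Proof. symmetry. apply mopp_unique. now rewrite maddACA, !maddNl, madd0l. Qed.
Lemma mopp0 : mopp (mzero E) = mzero E.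
Proof. symmetry. apply mopp_unique. apply madd0l. Qed.
Lemma mopp_rac x a : mopp (mrac x a) = mrac (mopp x) a.
Proof. symmetry. apply mopp_unique. now rewrite <- mracDl, maddNl, mrac0l. Qed.
End Fmod.

(** * Finite sums, and induction over elements that are finite sums *)

Lemma lsum_app {T : Type} (add : T -> T -> T) (z : T)
  (addA : forall x y t, add x (add y t) = add (add x y) t) (add0 : forall x, add z x = x) l1 l2 :
  lsum add z (l1 ++ l2) = add (lsum add z l1) (lsum add z l2).
Proof.
  induction l1 as [|a l1 IH]; simpl; [now rewrite add0|].
  unfold lsum in *. simpl. now rewrite IH, addA.
Qed.

Lemma lsum_morph {T U : Type} (add : T -> T -> T) z (add' : U -> U -> U) z' (h : T -> U) :
  h z = z' -> (forall x y, h (add x y) = add' (h x) (h y)) ->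
  forall l, h (lsum add z l) = lsum add' z' (map h l).
Proof. intros H0 Hadd l. induction l; simpl; [easy|]. unfold lsum in *; simpl. now rewrite Hadd, IHl. Qed.

Section Spans.
Context {G : group} {A : rdata G}.

(** The product case comes without induction hypotheses: its use is to present a ring element as
    [x y], so that one factor can be absorbed into a vector and the other into a functional. *)
Lemma quadratik_ind (HQ : quadratik A) (P : A -> Prop) :
  P (rzero A) -> (forall x y, P x -> P y -> P (radd x y)) -> (forall x y, P (rmul x y)) ->
  forall x, P x.
Proof.
  intros P0 PD PM x. destruct (HQ x) as [l ->].
  induction l as [|p l IH]; [exact P0|]. apply PD; auto.
Qed.

Lemma cofull_ind {E : fmod A} (HE : cofull E) (P : E -> Prop) :
  P (mzero E) -> (forall x y, P x -> P y -> P (madd x y)) ->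
  (forall x y (phi : Th E), P (mrac x (proj1_sig phi y))) -> forall x, P x.
Proof.
  intros P0 PD PM x. destruct (HE x) as [l ->].
  induction l as [|p l IH]; [exact P0|]. apply PD; auto.
Qed.

(** Converse of [cofull_ind]: take for [P] the property of being such a finite sum. *)
Lemma cofull_intro {E : fmod A} {HE : is_fmod E} :
  (forall P : E -> Prop, P (mzero E) -> (forall x y, P x -> P y -> P (madd x y)) ->
     (forall x y (phi : Th E), P (mrac x (proj1_sig phi y))) -> forall x, P x) -> cofull E.
Proof.
  intros H. red. apply H.
  - now exists nil.
  - intros x y [l ->] [l' ->]. exists (l ++ l').
    rewrite map_app. symmetry. apply lsum_app; [apply maddA|apply madd0l].
  - intros x y phi. exists [(x, y, phi)]. simpl. unfold lsum; simpl. now rewrite madd0r.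
Qed.

End Spans.

(** * Compact operators and direct summands *)

Section Compact.
Context {G : group} {A : rdata G} {HA : is_ring A}.

(** Compact maps between two modules; for [E = F] this unfolds to [isK]. The off-diagonal entries of
    operator matrices are of this kind. *)
Definition isKm {E F : fmod A} (T : E -> F) : Prop :=
  exists l : list (F * Th E),
    T = fun xi => lsum (madd (f:=F)) (mzero F)
                    (map (fun p => mrac (fst p) (proj1_sig (snd p) xi)) l).

Definition mod_map {E F : fmod A} (u : E -> F) : Prop :=
  (forall x y, u (madd x y) = madd (u x) (u y)) /\
  (forall x a, u (mrac x a) = mrac (u x) a).

(** For a module endomorphism this is the condition that defines [L_A(E)]. *)
Definition pullsTh {E F : fmod A} (u : E -> F) : Prop :=
  forall phi, mtheta phi -> mtheta (fun x => phi (u x)).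

Section One.
Context {E F : fmod A} {HE : is_fmod E} {HF : is_fmod F}.

Lemma isKm_ind (P : (E -> F) -> Prop) :
  P (fun _ => mzero F) ->
  (forall S T, isKm S -> isKm T -> P S -> P T -> P (fun x => madd (S x) (T x))) ->
  (forall eta phi, mtheta phi -> P (fun x => mrac eta (phi x))) ->
  forall T, isKm T -> P T.
Proof using HF.
  intros P0 PD PT T [l ->]. induction l as [|[eta phi] l IH]; [exact P0|].
  unfold lsum; simpl. apply (PD (fun x => mrac eta (proj1_sig phi x))).
  - exists [(eta, phi)]. apply functional_extensionality; intros x. unfold lsum; simpl. now rewrite madd0r.
  - now exists l.
  - apply PT. apply proj2_sig.
  - exact IH.
Qed.

Lemma isKm_zero : isKm (fun _ : E => mzero F).
Proof. now exists nil. Qed.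

Lemma isKm_add (S T : E -> F) : isKm S -> isKm T -> isKm (fun x => madd (S x) (T x)).
Proof using HF.
  intros [l ->] [l' ->]. exists (l ++ l'). apply functional_extensionality; intros x.
  rewrite map_app. symmetry. apply lsum_app; [apply maddA|apply madd0l].
Qed.

Lemma isKm_theta (eta : F) (phi : E -> A) : mtheta phi -> isKm (fun x => mrac eta (phi x)).
Proof using HF.
  intros H. exists [(eta, exist _ phi H)]. apply functional_extensionality; intros x.
  unfold lsum; simpl. now rewrite madd0r.
Qed.

Lemma isKm_ext (S T : E -> F) : (forall x, S x = T x) -> isKm S -> isKm T.
Proof. intros H. now replace T with S by (apply functional_extensionality, H). Qed.

Lemma isKm_mod_map (T : E -> F) : isKm T -> mod_map T.
Proof using HA HE HF.
  intros HT. pattern T. revert T HT. apply isKm_ind.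
  - split; intros; [now rewrite madd0l|now rewrite mrac0l].
  - intros S T _ _ [S1 S2] [T1 T2]. split; intros.
    + now rewrite S1, T1, maddACA.
    + now rewrite S2, T2, mracDl.
  - intros eta phi H. split; intros.
    + now rewrite (mthD _ H), mracDr.
    + now rewrite (mthZ _ H), mracA.
Qed.
End One.

Lemma mod_map0 {E F : fmod A} {HE : is_fmod E} {HF : is_fmod F} (u : E -> F) :
  mod_map u -> u (mzero E) = mzero F.
Proof. intros [H _]. apply madd_idem. now rewrite <- H, madd0l. Qed.

(** [U theta_{eta,phi} = theta_{U eta,phi}], so linearity of [U] suffices on this side. *)
Lemma isKm_comp_l {E F F' : fmod A} {HF : is_fmod F} {HF' : is_fmod F'} (U : F -> F') (T : E -> F) :
  mod_map U -> isKm T -> isKm (fun x => U (T x)).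
Proof.
  intros [U1 U2] HT. pattern T. revert T HT. apply isKm_ind.
  - rewrite (mod_map0 U (conj U1 U2)). apply isKm_zero.
  - intros S T _ _ HS HT. apply (isKm_ext (fun x => madd (U (S x)) (U (T x)))); [now intros; rewrite U1|].
    now apply isKm_add.
  - intros eta phi H. apply (isKm_ext (fun x => mrac (U eta) (phi x))); [now intros; rewrite U2|].
    now apply isKm_theta.
Qed.

(** [theta_{eta,phi} V = theta_{eta,phi V}], so on this side [V] must pull functionals back. *)
Lemma isKm_comp_r {E E' F : fmod A} {HF : is_fmod F} (T : E -> F) (V : E' -> E) :
  pullsTh V -> isKm T -> isKm (fun x => T (V x)).
Proof.
  intros HV HT. pattern T. revert T HT. apply isKm_ind.
  - apply isKm_zero.
  - intros S T _ _ HS HT. now apply (isKm_add (fun x => S (V x)) (fun x => T (V x))).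
  - intros eta phi H. apply (isKm_theta eta (fun x => phi (V x))). now apply HV.
Qed.

(** [phi theta_{eta,psi} = phi(eta) psi], and functionals form a left submodule. *)
Lemma isKm_pullsTh {E F : fmod A} {HE : is_fmod E} {HF : is_fmod F} (T : E -> F) : isKm T -> pullsTh T.
Proof.
  intros HT phi Hphi. pattern T. revert T HT. apply isKm_ind.
  - rewrite (mth_zero phi Hphi). apply mth0.
  - intros S T _ _ HS HT.
    replace (fun x => phi (madd (S x) (T x))) with (fun x => radd (phi (S x)) (phi (T x)))
      by (apply functional_extensionality; intros; now rewrite (mthD _ Hphi)).
    now apply mth_add.
  - intros eta psi H.
    replace (fun x => phi (mrac eta (psi x))) with (fun x => rmul (phi eta) (psi x))
      by (apply functional_extensionality; intros; now rewrite (mthZ _ Hphi)).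
    now apply mth_mul.
Qed.

Lemma isKm_conj {E F : fmod A} {HE : is_fmod E} {HF : is_fmod F} g (T : E -> F) :
  isKm T -> isKm (fun x => mS g (T (mS (ginv G g) x))).
Proof.
  intros HT. pattern T. revert T HT. apply isKm_ind.
  - rewrite mS0. apply isKm_zero.
  - intros S T _ _ HS HT.
    apply (isKm_ext (fun x => madd (mS g (S (mS (ginv G g) x))) (mS g (T (mS (ginv G g) x))))).
    + intros; now rewrite mSD.
    + now apply isKm_add.
  - intros eta phi H.
    apply (isKm_ext (fun x => mrac (mS g eta) (thact g phi x))).
    + intros; now rewrite mSrac.
    + apply isKm_theta. now apply mth_act.
Qed.

Section Kring.
Context {E : fmod A} {HE : is_fmod E}.

Lemma KextE (S T : Kring E) : (forall x, proj1_sig S x = proj1_sig T x) -> S = T.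
Proof. intros H. apply sig_ext. apply functional_extensionality, H. Qed.

Lemma K_isKm (T : Kring E) : isKm (proj1_sig T).
Proof. apply (proj2_sig T). Qed.

Lemma K_D (T : Kring E) x y : proj1_sig T (madd x y) = madd (proj1_sig T x) (proj1_sig T y).
Proof using HA HE. apply (isKm_mod_map _ (K_isKm T)). Qed.

Lemma K_Z (T : Kring E) x a : proj1_sig T (mrac x a) = mrac (proj1_sig T x) a.
Proof using HA HE. apply (isKm_mod_map _ (K_isKm T)). Qed.

Lemma K_0 (T : Kring E) : proj1_sig T (mzero E) = mzero E.
Proof using HA HE. apply mod_map0. apply (isKm_mod_map _ (K_isKm T)). Qed.

Lemma KaddE (S T : Kring E) x : proj1_sig (radd S T) x = madd (proj1_sig S x) (proj1_sig T x).
Proof using HE. simpl. rewrite mkE; [easy|]. exact (isKm_add _ _ (K_isKm S) (K_isKm T)). Qed.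

Lemma KmulE (S T : Kring E) x : proj1_sig (rmul S T) x = proj1_sig S (proj1_sig T x).
Proof using HA HE.
  simpl. rewrite mkE; [easy|].
  exact (isKm_comp_l (proj1_sig S) _ (isKm_mod_map _ (K_isKm S)) (K_isKm T)).
Qed.

Lemma KactE g (T : Kring E) x : proj1_sig (ract g T) x = mS g (proj1_sig T (mS (ginv G g) x)).
Proof using HE. simpl. rewrite mkE; [easy|]. exact (isKm_conj g _ (K_isKm T)). Qed.

Lemma KoppE (T : Kring E) x : proj1_sig (ropp T) x = mopp (proj1_sig T x).
Proof using HE.
  simpl. rewrite mkE; [easy|].
  refine (isKm_comp_l (mopp (f:=E)) _ _ (K_isKm T)).
  split; [apply moppD|intros; apply mopp_rac].
Qed.

Global Instance Kring_is_ring : is_ring (Kring E).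
Proof using HA HE.
  repeat split; intros; apply KextE; intros t;
    rewrite ?KaddE, ?KmulE, ?KactE, ?KaddE, ?KmulE, ?KactE, ?KoppE, ?KaddE, ?KmulE, ?KactE, ?K_D; simpl.
  - apply maddA.
  - apply maddC.
  - apply madd0l.
  - apply maddNl.
  - reflexivity.
  - reflexivity.
  - reflexivity.
  - apply mSD.
  - now rewrite mSVK.
  - now rewrite ginv1, !mS1.
  - now rewrite ginvM, !mSG.
Qed.

(** By cofullness [eta] may be taken to be [x psi(y)], and [theta_{x psi(y),phi} = theta_{x,psi}
    theta_{y,phi}]. *)
Lemma Kring_quadratik (HC : cofull E) : quadratik (Kring E).
Proof using HA HE.
  set (Q := fun x : Kring E => exists l : list (Kring E * Kring E),
    x = lsum (radd (r:=Kring E)) (rzero _) (map (fun p => rmul (fst p) (snd p)) l)).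
  assert (Q0 : Q (rzero _)) by now exists nil.
  assert (QD : forall x y, Q x -> Q y -> Q (radd x y)).
  { intros x y [l ->] [l' ->]. exists (l ++ l'). rewrite map_app. symmetry.
    apply lsum_app; [apply raddA|apply radd0l]. }
  assert (QM : forall x y, Q (rmul x y)).
  { intros x y. exists [(x, y)]. exact (eq_sym (radd0r _)). }
  assert (QE : forall S T : Kring E, (forall x, proj1_sig S x = proj1_sig T x) -> Q S -> Q T)
    by (intros S T ST; now rewrite (KextE S T ST)).
  assert (QT : forall T : E -> E, isKm T -> forall H : isK T, Q (exist _ T H)).
  { apply (isKm_ind (fun T : E -> E => forall H : isK T, Q (exist _ T H))).
    - intros H. now apply (QE (rzero (Kring E))).
    - intros S T HS HT IS IT H.
      apply (QE (radd (r:=Kring E) (exist _ S HS) (exist _ T HT))); [|apply QD; [apply IS|apply IT]].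
      intros x. now rewrite KaddE.
    - intros eta phi Hphi. pattern eta. revert eta. apply (cofull_ind HC).
      + intros H. apply (QE (rzero (Kring E))); [|exact Q0]. intros x. simpl. now rewrite mrac0l.
      + intros x y Ix Iy H.
        apply (QE (radd (r:=Kring E) (exist _ _ (isKm_theta x phi Hphi)) (exist _ _ (isKm_theta y phi Hphi))));
          [|apply QD; [apply Ix|apply Iy]].
        intros z. rewrite KaddE. simpl. now rewrite mracDl.
      + intros x y psi H.
        apply (QE (rmul (r:=Kring E) (exist _ _ (isKm_theta x _ (proj2_sig psi))) (exist _ _ (isKm_theta y phi Hphi))));
          [|apply QM].
        intros z. rewrite KmulE. simpl. now rewrite (mthZ _ (proj2_sig psi)), mracA. }
  intros [T H]. now apply QT.
Qed.

Lemma Kring_obj (HC : cofull E) : is_obj (Kring E).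
Proof using HA HE. split; [exact Kring_is_ring|now apply Kring_quadratik]. Qed.
End Kring.

Definition equiv_map {E F : fmod A} (u : E -> F) : Prop :=
  forall g x, u (mS g x) = mS g (u x).

(** An equivariant direct summand. As both maps pull functionals back, [T |-> i T p] preserves
    compactness, and [p i = 1] makes it multiplicative: it is the inclusion of a corner of
    [K(Z)]. *)
Record slot (P Z : fmod A) (i : P -> Z) (p : Z -> P) : Prop := Slot {
  slot_im : mod_map i; slot_ie : equiv_map i; slot_it : pullsTh i;
  slot_pm : mod_map p; slot_pe : equiv_map p; slot_pt : pullsTh p;
  slot_pi : forall x, p (i x) = x }.

Definition Kmap {P Z : fmod A} (i : P -> Z) (p : Z -> P) (T : Kring P) : Kring Z :=
  mk (K0 Z) (fun z => i (proj1_sig T (p z))).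

Section Slots.
Context {P Q Z : fmod A} {HP : is_fmod P} {HQ : is_fmod Q} {HZ : is_fmod Z}.

Lemma slot_isKm i p j q (HP' : slot P Z i p) (HQ' : slot Q Z j q) (T : P -> Q) :
  isKm T -> isK (fun z => j (T (p z))).
Proof using HP HQ HZ.
  intros HT. apply (isKm_comp_l j (fun z => T (p z))); [apply HQ'|].
  apply (isKm_comp_r T p); [apply HP'|exact HT].
Qed.

Lemma KmapE i p (H : slot P Z i p) (T : Kring P) z :
  proj1_sig (Kmap i p T) z = i (proj1_sig T (p z)).
Proof using HP HZ.
  unfold Kmap. rewrite mkE; [easy|].
  apply (isKm_comp_l i (fun z => proj1_sig T (p z))); [apply H|].
  apply (isKm_comp_r (proj1_sig T) p); [apply H|apply K_isKm].
Qed.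

Lemma Kmap_hom i p (H : slot P Z i p) : is_hom (Kmap i p).
Proof using HA HP HZ.
  repeat split; intros; apply KextE; intros z.
  - rewrite KaddE, !(KmapE i p H), KaddE. apply (slot_im _ _ _ _ H).
  - now rewrite KmulE, !(KmapE i p H), KmulE, (slot_pi _ _ _ _ H).
  - now rewrite KactE, !(KmapE i p H), KactE, (slot_ie _ _ _ _ H), (slot_pe _ _ _ _ H).
Qed.
End Slots.

Lemma slot_comp {P Y Z : fmod A} i p j q :
  slot P Y i p -> slot Y Z j q -> slot P Z (fun x => j (i x)) (fun z => p (q z)).
Proof.
  intros [im ie it pm pe pt pi] [jm je jt qm qe qt qj]. split.
  - split; intros; [now rewrite (proj1 im), (proj1 jm)|now rewrite (proj2 im), (proj2 jm)].
  - intros g x. now rewrite ie, je.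
  - intros phi H. apply (it (fun y => phi (j y))). now apply jt.
  - split; intros; [now rewrite (proj1 qm), (proj1 pm)|now rewrite (proj2 qm), (proj2 pm)].
  - intros g x. now rewrite qe, pe.
  - intros phi H. apply (qt (fun y => phi (p y))). now apply pt.
  - intros x. now rewrite qj, pi.
Qed.

Section Esum.
Context {E H : fmod A} {HE : is_fmod E} {HH : is_fmod H}.

Global Instance Esum_is_fmod : is_fmod (Esum E H).
Proof using HA HE HH.
  repeat apply conj.
  - intros [x1 x2] [y1 y2] [z1 z2]. simpl. now rewrite !maddA.
  - intros [x1 x2] [y1 y2]. simpl. now rewrite (maddC x1), (maddC x2).
  - intros [x1 x2]. simpl. now rewrite !madd0l.
  - intros [x1 x2]. simpl. now rewrite !maddNl.
  - intros [x1 x2] [y1 y2] a. simpl. now rewrite !mracDl.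
  - intros [x1 x2] a b. simpl. now rewrite !mracDr.
  - intros [x1 x2] a b. simpl. now rewrite !mracA.
  - intros g [x1 x2] [y1 y2]. simpl. now rewrite !mSD.
  - intros [x1 x2]. simpl. now rewrite !mS1.
  - intros g h [x1 x2]. simpl. now rewrite !mSG.
  - intros g [x1 x2] a. simpl. now rewrite !mSrac.
  - intros chi (phi & psi & Hphi & Hpsi & ->). split.
    + intros [x1 x2] [y1 y2]. simpl. rewrite (mthD _ Hphi), (mthD _ Hpsi). apply raddACA.
    + intros [x1 x2] a. simpl. now rewrite (mthZ _ Hphi), (mthZ _ Hpsi), rmulDl.
  - exists (fun _ => rzero A), (fun _ => rzero A). repeat split; try apply mth0.
    apply functional_extensionality; intros x. now rewrite radd0l.
  - intros c1 c2 (phi & psi & Hphi & Hpsi & ->) (phi' & psi' & Hphi' & Hpsi' & ->).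
    exists (fun x => radd (phi x) (phi' x)), (fun x => radd (psi x) (psi' x)).
    repeat split; try now apply mth_add. apply functional_extensionality; intros x. apply raddACA.
  - intros a c (phi & psi & Hphi & Hpsi & ->).
    exists (fun x => rmul a (phi x)), (fun x => rmul a (psi x)).
    repeat split; try now apply mth_mul. apply functional_extensionality; intros x. apply rmulDr.
  - intros g c (phi & psi & Hphi & Hpsi & ->).
    exists (thact g phi), (thact g psi).
    repeat split; try now apply mth_act. apply functional_extensionality; intros x. apply ractD.
Qed.

Lemma slot_fst : slot E (Esum E H) (fun x => (x, mzero H)) fst.
Proof using HA HE HH.
  split; try easy.
  - split; intros; simpl; [now rewrite madd0l|now rewrite mrac0l].
  - intros g x. simpl. now rewrite mS0.
  - intros c (phi & psi & Hphi & Hpsi & ->). simpl.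
    replace (fun x : E => radd (phi x) (psi (mzero H))) with phi; [easy|].
    apply functional_extensionality; intros x. now rewrite (mth_zero psi Hpsi), radd0r.
  - intros phi Hphi. exists phi, (fun _ => rzero A). repeat split; [easy|apply mth0|].
    apply functional_extensionality; intros x. now rewrite radd0r.
Qed.

Lemma slot_snd : slot H (Esum E H) (fun x => (mzero E, x)) snd.
Proof using HA HE HH.
  split; try easy.
  - split; intros; simpl; [now rewrite madd0l|now rewrite mrac0l].
  - intros g x. simpl. now rewrite mS0.
  - intros c (phi & psi & Hphi & Hpsi & ->). simpl.
    replace (fun x : H => radd (phi (mzero E)) (psi x)) with psi; [easy|].
    apply functional_extensionality; intros x. now rewrite (mth_zero phi Hphi), radd0l.
  - intros psi Hpsi. exists (fun _ => rzero A), psi. repeat split; [apply mth0|easy|].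
    apply functional_extensionality; intros x. now rewrite radd0l.
Qed.

Lemma Esum_cofull : cofull E -> cofull H -> cofull (Esum E H).
Proof using HA HE HH.
  intros CE CH. apply cofull_intro. intros P P0 PD PT.
  assert (P1 : forall x, P (x, mzero H)).
  { apply (cofull_ind CE); [exact P0| |].
    - intros x y Px Py. specialize (PD _ _ Px Py). simpl in PD. now rewrite madd0l in PD.
    - intros x y phi.
      specialize (PT (x, mzero H) (y, mzero H) (exist _ _ (slot_pt _ _ _ _ slot_fst _ (proj2_sig phi)))).
      simpl in PT. now rewrite mrac0l in PT. }
  assert (P2 : forall x, P (mzero E, x)).
  { apply (cofull_ind CH); [exact P0| |].
    - intros x y Px Py. specialize (PD _ _ Px Py). simpl in PD. now rewrite madd0l in PD.
    - intros x y phi.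
      specialize (PT (mzero E, x) (mzero E, y) (exist _ _ (slot_pt _ _ _ _ slot_snd _ (proj2_sig phi)))).
      simpl in PT. now rewrite mrac0l in PT. }
  intros [x y]. specialize (PD _ _ (P1 x) (P2 y)). simpl in PD. now rewrite madd0l, madd0r in PD.
Qed.
End Esum.
End Compact.

(** * The internal tensor product *)

Lemma ginvK {G : group} (x : G) : ginv G (ginv G x) = x.
Proof. symmetry. apply ginv_unique. apply gmulV. Qed.

Section Tensor.
Context {G : group} {B A : rdata G} {HB : is_ring B} {HA : is_ring A}.
Context {F : fmod A} {HF : is_fmod F} (n : B -> Kring F) (Hn : is_hom n).

Notation pi := (fun b => proj1_sig (n b)).

Lemma pi_add b c y : pi (radd b c) y = madd (pi b y) (pi c y).
Proof using HF Hn. destruct Hn as (H & _ & _). now rewrite H, KaddE. Qed.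

Lemma pi_mul b c y : pi (rmul b c) y = pi b (pi c y).
Proof using HA HF Hn. destruct Hn as (_ & H & _). now rewrite H, KmulE. Qed.

Lemma pi_act g b y : pi (ract g b) (mS g y) = mS g (pi b y).
Proof using HF Hn. destruct Hn as (_ & _ & H). now rewrite H, KactE, mSVK. Qed.

Lemma pi_zero y : pi (rzero B) y = mzero F.
Proof using HB HF Hn. apply madd_idem. now rewrite <- pi_add, radd0l. Qed.

Section One.
Context {X : fmod B} {HX : is_fmod X}.
Notation T := (tensor X pi).

(* All operations of the tensor product are computed on chosen representatives;
   their effect on the values [tval z phi] is independent of this choice. *)
Definition tval (z : T) (phi : Th X) : F := proj1_sig z phi.

Lemma tval_ext (y z : T) : (forall phi, tval y phi = tval z phi) -> y = z.
Proof. intros H. apply sig_ext. apply functional_extensionality, H. Qed.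

Lemma trepE (z : T) : proj1_sig z = tev pi (trep z).
Proof. unfold trep. apply epsilon_spec. exact (proj2_sig z). Qed.

Lemma tval_trep (z : T) phi : tval z phi = tev pi (trep z) phi.
Proof. exact (f_equal (fun h => h phi) (trepE z)). Qed.

Lemma tev_app l l' (phi : Th X) : tev pi (l ++ l') phi = madd (tev pi l phi) (tev pi l' phi).
Proof using HF. unfold tev. rewrite map_app. apply lsum_app; [apply maddA|apply madd0l]. Qed.

Lemma tval_add (y z : T) phi : tval (madd y z) phi = madd (tval y phi) (tval z phi).
Proof using HF. unfold tval at 1; simpl. now rewrite tev_app, !tval_trep. Qed.

Lemma tval_zero phi : tval (mzero T) phi = mzero F.
Proof. reflexivity. Qed.

(** The tensor operations change a representative term by term; this turns a rule for elementary
    tensors into one for values. *)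
Lemma tev_map (h : X * F -> X * F) (k : F -> F) (phi psi : Th X) :
  k (mzero F) = mzero F -> (forall x y, k (madd x y) = madd (k x) (k y)) ->
  (forall p, pi (proj1_sig psi (fst (h p))) (snd (h p)) = k (pi (proj1_sig phi (fst p)) (snd p))) ->
  forall l, tev pi (map h l) psi = k (tev pi l phi).
Proof.
  intros k0 kD kh l. unfold tev. rewrite map_map. rewrite (lsum_morph _ _ _ _ k k0 kD), map_map.
  f_equal. apply map_ext. exact kh.
Qed.

Lemma tval_opp (z : T) phi : tval (mopp z) phi = mopp (tval z phi).
Proof using HA HB HF HX Hn.
  rewrite (tval_trep z). unfold tval; simpl. apply (tev_map _ (mopp (f:=F)) phi phi); [apply mopp0|apply moppD|].
  intros [x y]; simpl. apply mopp_unique.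
  rewrite <- pi_add, <- (mthD _ (proj2_sig phi)), maddNl, (mth_zero _ (proj2_sig phi)). apply pi_zero.
Qed.

Lemma tval_rac (z : T) a phi : tval (mrac z a) phi = mrac (tval z phi) a.
Proof using HA HF.
  rewrite (tval_trep z). unfold tval; simpl. apply (tev_map _ (fun y => mrac y a) phi phi).
  - apply mrac0l.
  - intros; apply mracDl.
  - intros [x y]; simpl. apply K_Z.
Qed.

Definition thact_Th g (phi : Th X) : Th X := exist _ _ (mth_act g _ (proj2_sig phi)).

Lemma tval_act g (z : T) phi : tval (mS g z) phi = mS g (tval z (thact_Th (ginv G g) phi)).
Proof using HB HF Hn.
  rewrite (tval_trep z). unfold tval; simpl. apply (tev_map _ (mS g) (thact_Th (ginv G g) phi) phi).
  - apply mS0.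
  - intros; apply mSD.
  - intros [x y]; simpl. unfold thact. now rewrite ginvK, <- pi_act, ractK.
Qed.

Definition pure (x : X) (y : F) : T := tcls pi [(x, y)].

Lemma tval_pure x y phi : tval (pure x y) phi = pi (proj1_sig phi x) y.
Proof using HF. unfold tval, tev, lsum; simpl. apply madd0r. Qed.

Lemma tensor_ind (P : T -> Prop) :
  P (mzero T) -> (forall y z, P y -> P z -> P (madd y z)) -> (forall x y, P (pure x y)) -> forall z, P z.
Proof using HF.
  intros P0 PD PP z. replace z with (tcls pi (trep z)).
  - induction (trep z) as [|[x y] l IH]; [exact P0|].
    replace (tcls pi ((x, y) :: l)) with (madd (f:=T) (pure x y) (tcls pi l)); [now apply PD|].
    apply tval_ext; intros phi. rewrite tval_add, tval_pure. reflexivity.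
  - apply sig_ext. symmetry. apply trepE.
Qed.

Lemma tval_phi_add (z : T) (phi psi chi : Th X) :
  (forall x, proj1_sig chi x = radd (proj1_sig phi x) (proj1_sig psi x)) ->
  tval z chi = madd (tval z phi) (tval z psi).
Proof using HF Hn.
  intros H. revert z. apply tensor_ind.
  - now rewrite !tval_zero, madd0l.
  - intros y z Hy Hz. now rewrite !tval_add, Hy, Hz, maddACA.
  - intros x y. now rewrite !tval_pure, H, pi_add.
Qed.

Lemma tval_phi_mul (z : T) b (phi chi : Th X) :
  (forall x, proj1_sig chi x = rmul b (proj1_sig phi x)) -> tval z chi = pi b (tval z phi).
Proof using HA HF Hn.
  intros H. revert z. apply tensor_ind.
  - now rewrite !tval_zero, K_0.
  - intros y z Hy Hz. now rewrite !tval_add, Hy, Hz, K_D.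
  - intros x y. now rewrite !tval_pure, H, pi_mul.
Qed.

Lemma tval_phi_ext (z : T) (phi chi : Th X) :
  (forall x, proj1_sig chi x = proj1_sig phi x) -> tval z chi = tval z phi.
Proof. intros H. f_equal. apply sig_ext, functional_extensionality, H. Qed.

Lemma tval_phi_zero (z : T) (phi : Th X) :
  (forall x, proj1_sig phi x = rzero B) -> tval z phi = mzero F.
Proof using HA HB HF Hn.
  intros H. apply madd_idem. rewrite <- (tval_phi_add z phi phi phi); [easy|].
  intros x. now rewrite H, radd0l.
Qed.

(** Functionals of the tensor product are defined on a chosen representative; rewriting
    [phi (x) psi] as [z |-> psi(z(phi))] removes the choice. *)
Lemma tensor_theta_eq (phi : Th X) (psi : Th F) (z : T) :
  lsum (radd (r:=A)) (rzero A)
    (map (fun p => proj1_sig psi (pi (proj1_sig phi (fst p)) (snd p))) (trep z)) =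
  proj1_sig psi (tval z phi).
Proof using HA HF.
  rewrite tval_trep. unfold tev.
  rewrite (lsum_morph _ _ _ _ _ (mth_zero _ (proj2_sig psi)) (mthD _ (proj2_sig psi))).
  now rewrite map_map.
Qed.

Lemma tensor_theta_intro (l : list (Th X * Th F)) :
  mtheta (f:=T) (fun z => lsum (radd (r:=A)) (rzero A)
                   (map (fun q => proj1_sig (snd q) (tval z (fst q))) l)).
Proof using HA HF.
  exists l. apply functional_extensionality; intros z. f_equal. apply map_ext.
  intros q. symmetry. apply tensor_theta_eq.
Qed.

Lemma tensor_theta_pure (phi : Th X) (psi : F -> A) :
  mtheta psi -> mtheta (f:=T) (fun z => psi (tval z phi)).
Proof using HA HF.
  intros H. generalize (tensor_theta_intro [(phi, exist _ psi H)]).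
  match goal with |- mtheta ?f -> mtheta ?g => replace f with g; [easy|] end.
  apply functional_extensionality; intros z. unfold lsum; simpl. now rewrite radd0r.
Qed.

Lemma tensor_theta_zero : mtheta (f:=T) (fun _ => rzero A).
Proof using HA HF. exact (tensor_theta_intro nil). Qed.

Lemma tensor_theta_add (f h : T -> A) : mtheta f -> mtheta h -> mtheta (fun z => radd (f z) (h z)).
Proof using HA HF.
  intros [l ->] [l' ->]. exists (l ++ l'). apply functional_extensionality; intros z.
  rewrite map_app. symmetry. apply lsum_app; [apply raddA|apply radd0l].
Qed.

Lemma tensor_theta_ind (P : (T -> A) -> Prop) :
  P (fun _ => rzero A) ->
  (forall f h, mtheta f -> mtheta h -> P f -> P h -> P (fun z => radd (f z) (h z))) ->
  (forall phi psi, mtheta psi -> P (fun z => psi (tval z phi))) ->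
  forall f, mtheta f -> P f.
Proof using HA HF.
  intros P0 PD PP f [l ->].
  match goal with |- P ?f => replace f with
    (fun z => lsum (radd (r:=A)) (rzero A) (map (fun q => proj1_sig (snd q) (tval z (fst q))) l)) end.
  - induction l as [|[phi psi] l IH]; [exact P0|].
    apply (PD (fun z => proj1_sig psi (tval z phi))).
    + apply tensor_theta_pure, proj2_sig.
    + apply tensor_theta_intro.
    + apply PP, proj2_sig.
    + exact IH.
  - apply functional_extensionality; intros z. f_equal. apply map_ext.
    intros q. symmetry. apply tensor_theta_eq.
Qed.

Global Instance tensor_is_fmod : is_fmod T.
Proof using HA HB HF HX Hn.
  repeat apply conj; intros; try (apply tval_ext; intros chi);
    do 2 rewrite ?tval_add, ?tval_zero, ?tval_opp, ?tval_rac, ?tval_act.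
  - apply maddA.
  - apply maddC.
  - apply madd0l.
  - apply maddNl.
  - apply mracDl.
  - apply mracDr.
  - apply mracA.
  - apply mSD.
  - rewrite mS1. apply tval_phi_ext. intros t. simpl. unfold thact. now rewrite !ginv1, mS1, ract1.
  - rewrite mSG. do 2 f_equal. apply tval_phi_ext. intros t. simpl. unfold thact.
    now rewrite !ginvK, ginvM, ractG, mSG.
  - now rewrite mSrac.
  - revert phi H. apply tensor_theta_ind.
    + split; intros; [now rewrite radd0l|now rewrite rmul0l].
    + intros f h _ _ [f1 f2] [h1 h2]. split; intros; [rewrite f1, h1; apply raddACA|now rewrite f2, h2, rmulDl].
    + intros phi psi H. split; intros; [now rewrite tval_add, (mthD _ H)|now rewrite tval_rac, (mthZ _ H)].
  - apply tensor_theta_zero.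
  - now apply tensor_theta_add.
  - revert phi H. apply tensor_theta_ind.
    + rewrite rmul0r. apply tensor_theta_zero.
    + intros f h _ _ Hf Hh.
      replace (fun x : T => rmul a (radd (f x) (h x))) with (fun x : T => radd (rmul a (f x)) (rmul a (h x)))
        by (apply functional_extensionality; intros; now rewrite rmulDr).
      now apply tensor_theta_add.
    + intros phi psi H. apply (tensor_theta_pure phi (fun y => rmul a (psi y))). now apply mth_mul.
  - revert phi H. apply tensor_theta_ind.
    + unfold thact. rewrite ract0. apply tensor_theta_zero.
    + intros f h _ _ Hf Hh. unfold thact in *.
      match goal with |- mtheta ?f' => replace f' with
        (fun x : T => radd (ract g (f (mS (ginv G g) x))) (ract g (h (mS (ginv G g) x)))) end.
      * now apply (tensor_theta_add (fun x : T => ract g (f (mS (ginv G g) x)))).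
      * apply functional_extensionality; intros; now rewrite ractD.
    + intros phi psi H. unfold thact.
      generalize (tensor_theta_pure (thact_Th g phi) _ (mth_act g psi H)). unfold thact.
      match goal with |- mtheta ?f -> mtheta ?g => replace f with g; [easy|] end.
      apply functional_extensionality; intros z. rewrite tval_act. do 3 f_equal.
      apply tval_phi_ext. intros t. simpl. unfold thact. now rewrite ginvK.
Qed.

Lemma pure_addl x x' y : pure (madd x x') y = madd (f:=T) (pure x y) (pure x' y).
Proof using HF HX Hn.
  apply tval_ext; intros phi. now rewrite tval_add, !tval_pure, (mthD _ (proj2_sig phi)), pi_add.
Qed.

Lemma pure_zerol y : pure (mzero X) y = mzero T.
Proof using HA HB HF HX Hn. apply madd_idem. now rewrite <- pure_addl, madd0l. Qed.

Lemma pure_mod_map x : mod_map (E:=F) (F:=T) (pure x).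
Proof using HA HF.
  split; intros; apply tval_ext; intros phi.
  - now rewrite tval_add, !tval_pure, K_D.
  - now rewrite tval_rac, !tval_pure, K_Z.
Qed.

Lemma pure_balanced x b y : pure (mrac x b) y = pure x (pi b y).
Proof using HA HF HX Hn.
  apply tval_ext; intros phi. now rewrite !tval_pure, (mthZ _ (proj2_sig phi)), pi_mul.
Qed.

Lemma pure_act g x y : mS (f:=T) g (pure x y) = pure (mS g x) (mS g y).
Proof using HB HF Hn HX.
  apply tval_ext; intros phi. rewrite tval_act, !tval_pure. simpl. unfold thact.
  now rewrite ginvK, <- pi_act, ractK.
Qed.

(** Cofullness reduces to vectors [x phi(x')], and [x phi(x') (x) y = x (x) n(phi(x')) y] factors
    through a compact operator of [F]. *)
Lemma pure_isKm (CX : cofull X) x : isKm (E:=F) (F:=T) (pure x).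
Proof using HA HB HF HX Hn.
  revert x. apply (cofull_ind CX).
  - apply (isKm_ext (fun _ => mzero T)); [|apply isKm_zero]. intros y. now rewrite pure_zerol.
  - intros x x' Hx Hx'. apply (isKm_ext (fun y => madd (f:=T) (pure x y) (pure x' y))).
    + intros y. now rewrite pure_addl.
    + now apply isKm_add.
  - intros x x' phi. apply (isKm_ext (fun y => pure x (pi (proj1_sig phi x') y))).
    + intros y. now rewrite pure_balanced.
    + apply (isKm_comp_l (F:=F) (F':=T)); [apply pure_mod_map|apply K_isKm].
Qed.

(** The dual of [pure_isKm]: evaluation at [b phi] is evaluation at [phi] followed by the compact
    operator [n(b)]. *)
Lemma tval_isKm b (phi chi : Th X) :
  (forall x, proj1_sig chi x = rmul b (proj1_sig phi x)) -> isKm (E:=T) (F:=F) (fun z => tval z chi).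
Proof using HA HF Hn.
  intros H. apply (isKm_ext (fun z => pi b (tval z phi))).
  - intros z. symmetry. now apply tval_phi_mul.
  - apply (isKm_comp_r (E':=T) (pi b) (fun z => tval z phi)); [|apply K_isKm].
    intros psi Hpsi. now apply tensor_theta_pure.
Qed.

(** Moving [phi(x')] across the tensor sign twice gives [x (x) n(b) z(phi)]. Since [n(b)] is
    compact, this is a sum of terms [x (x) y psi(z(phi))], that is, of [x (x) y] times the value of
    [phi (x) psi] at [z]. *)
Lemma tensor_cofull (CX : cofull X) : cofull T.
Proof using HA HB HF HX Hn.
  apply cofull_intro. intros P P0 PD PT.
  assert (H1 : forall x z phi, P (pure x (tval z phi))).
  { intros x z phi. revert x. apply (cofull_ind CX).
    - now rewrite pure_zerol.
    - intros x x' Hx Hx'. rewrite pure_addl. now apply PD.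
    - intros x x' chi. rewrite pure_balanced.
      generalize (K_isKm (n (proj1_sig chi x'))). generalize (proj1_sig (n (proj1_sig chi x'))).
      apply isKm_ind.
      + now rewrite (mod_map0 (E:=F) (F:=T) _ (pure_mod_map x)).
      + intros S S' _ _ HS HS'. rewrite (proj1 (pure_mod_map x)). now apply PD.
      + intros y psi Hpsi. rewrite (proj2 (pure_mod_map x)).
        exact (PT (pure x y) z (exist _ _ (tensor_theta_pure phi psi Hpsi))). }
  apply tensor_ind; [exact P0|exact PD|]. intros x y. revert x. apply (cofull_ind CX).
  - now rewrite pure_zerol.
  - intros x x' Hx Hx'. rewrite pure_addl. now apply PD.
  - intros x x' phi. rewrite pure_balanced, <- tval_pure. apply H1.
Qed.
End One.

(** * Functoriality of the tensor product in its first factor *)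

Section Map.
Context {X Y : fmod B} {HX : is_fmod X} {HY : is_fmod Y}.

Definition tmap (u : X -> Y) (z : tensor X pi) : tensor Y pi :=
  tcls pi (map (fun p => (u (fst p), snd p)) (trep z)).

Definition Th_comp (u : X -> Y) (H : pullsTh u) (phi : Th Y) : Th X :=
  exist _ _ (H _ (proj2_sig phi)).

(** [tmap] acts on a chosen representative; the choice does not matter once [phi u] is again a
    functional, because the new value at [phi] is the old value at [phi u]. *)
Lemma tval_tmap u (H : pullsTh u) z phi : tval (tmap u z) phi = tval z (Th_comp u H phi).
Proof.
  rewrite (tval_trep z). unfold tval; simpl. unfold tev. now rewrite map_map.
Qed.

Lemma tmap_pure u (H : pullsTh u) x y : tmap u (pure x y) = pure (u x) y.
Proof using HF. apply tval_ext; intros phi. now rewrite (tval_tmap u H), !tval_pure. Qed.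

Lemma tmap_mod_map u (H : pullsTh u) : mod_map (tmap u).
Proof using HA HF.
  split; intros; apply tval_ext; intros phi.
  - now rewrite tval_add, !(tval_tmap u H), tval_add.
  - now rewrite tval_rac, !(tval_tmap u H), tval_rac.
Qed.

Lemma tmap_pullsTh u (H : pullsTh u) : pullsTh (tmap u).
Proof using HA HF.
  refine (tensor_theta_ind (X:=Y) (fun f => mtheta (f:=tensor X pi) (fun z => f (tmap u z))) _ _ _).
  - apply tensor_theta_zero.
  - intros f h _ _ Hf Hh. now apply (tensor_theta_add (fun z => f (tmap u z))).
  - intros phi psi Hpsi.
    generalize (tensor_theta_pure (X:=X) (Th_comp u H phi) psi Hpsi).
    match goal with |- mtheta ?f -> mtheta ?g => replace f with g; [easy|] end.
    apply functional_extensionality; intros z. now rewrite (tval_tmap u H).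
Qed.

Lemma tmap_equiv u (H : pullsTh u) : equiv_map u -> equiv_map (tmap u).
Proof using HB HF HX HY Hn.
  intros E g z. apply tval_ext; intros phi. rewrite (tval_tmap u H), !tval_act, (tval_tmap u H).
  f_equal. apply tval_phi_ext. intros x. simpl. unfold thact. now rewrite E.
Qed.

(** [theta_{y,phi} (x) 1] is evaluation at [phi] followed by [y (x) -]. The second map is compact by
    cofullness of [Y], and the first pulls [psi] back to [phi (x) psi]. *)
Lemma tmap_isKm (CY : cofull Y) (S : X -> Y) : isKm S -> isKm (tmap S).
Proof using HA HB HF HX HY Hn.
  revert S. apply isKm_ind.
  - apply (isKm_ext (fun _ => mzero (tensor Y pi))); [|apply isKm_zero].
    assert (H : pullsTh (fun _ : X => mzero Y)) by (apply isKm_pullsTh, isKm_zero).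
    intros z. apply tval_ext; intros phi. rewrite (tval_tmap _ H). symmetry. apply tval_phi_zero.
    intros x. simpl. apply (mth_zero _ (proj2_sig phi)).
  - intros S S' HS HS' IS IS'.
    apply (isKm_ext (fun z => madd (tmap S z) (tmap S' z))); [|now apply isKm_add].
    intros z. apply tval_ext; intros phi.
    rewrite tval_add, (tval_tmap _ (isKm_pullsTh _ HS)), (tval_tmap _ (isKm_pullsTh _ HS')).
    rewrite (tval_tmap _ (isKm_pullsTh _ (isKm_add _ _ HS HS'))).
    symmetry. apply tval_phi_add. intros x. simpl. apply (mthD _ (proj2_sig phi)).
  - intros y phi Hphi.
    apply (isKm_ext (fun z => pure y (tval z (exist _ phi Hphi)))).
    + intros z. apply tval_ext; intros chi. rewrite tval_pure.
      rewrite (tval_tmap _ (isKm_pullsTh _ (isKm_theta y phi Hphi))).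
      symmetry. apply tval_phi_mul. intros x. simpl. apply (mthZ _ (proj2_sig chi)).
    + apply (isKm_comp_r (E:=F) (E':=tensor X pi) (F:=tensor Y pi) (pure y)); [|now apply pure_isKm].
      intros psi Hpsi. now apply tensor_theta_pure.
Qed.
End Map.

Lemma tmap_slot {X Y : fmod B} {HX : is_fmod X} {HY : is_fmod Y} i p :
  slot X Y i p -> slot (tensor X pi) (tensor Y pi) (tmap i) (tmap p).
Proof using HA HB HF Hn.
  intros [im ie it pm pe pt pi']. split.
  - now apply tmap_mod_map.
  - now apply tmap_equiv.
  - now apply tmap_pullsTh.
  - now apply tmap_mod_map.
  - now apply tmap_equiv.
  - now apply tmap_pullsTh.
  - intros z. apply tval_ext; intros phi. rewrite (tval_tmap p pt), (tval_tmap i it).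
    apply tval_phi_ext. intros x. simpl. now rewrite pi'.
Qed.

Definition Ktensor (X : fmod B) (S : Kring X) : Kring (tensor X pi) :=
  mk (K0 _) (tmap (proj1_sig S)).

Section Ktensor.
Context {X : fmod B} {HX : is_fmod X} (CX : cofull X).

Lemma KtensorE (S : Kring X) z : proj1_sig (Ktensor X S) z = tmap (proj1_sig S) z.
Proof using HA HB HF HX Hn CX.
  unfold Ktensor. rewrite mkE; [easy|]. apply (tmap_isKm CX), K_isKm.
Qed.

Lemma K_pulls (S : Kring X) : pullsTh (proj1_sig S).
Proof using HB HX. apply isKm_pullsTh, K_isKm. Qed.

Lemma Ktensor_hom : is_hom (Ktensor X).
Proof using HA HB HF HX Hn CX.
  repeat split; intros; apply KextE; intros z; apply tval_ext; intros phi; rewrite KtensorE, (tval_tmap _ (K_pulls _)).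
  - rewrite KaddE, !KtensorE, tval_add, !(tval_tmap _ (K_pulls _)).
    apply tval_phi_add. intros t. cbn [Th_comp proj1_sig]. rewrite KaddE. apply (mthD _ (proj2_sig phi)).
  - rewrite KmulE, !KtensorE, !(tval_tmap _ (K_pulls _)).
    apply tval_phi_ext. intros t. cbn [Th_comp proj1_sig]. now rewrite KmulE.
  - rewrite KactE, KtensorE, tval_act, (tval_tmap _ (K_pulls _)), tval_act.
    rewrite mSK. apply tval_phi_ext. intros t. cbn [Th_comp thact_Th proj1_sig]. unfold thact.
    cbn [Th_comp thact_Th proj1_sig]. unfold thact.
    now rewrite KactE, !ginvK, ractK.
Qed.
End Ktensor.
End Tensor.

(** * The corner embedding with one copy of the ring *)

Section Corner.
Context {G : group} {A : rdata G} {HA : is_ring A} (QA : quadratik A).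

Notation H1 := (Hcar A unit).

Lemma unit_support (f : unit -> A) : exists l : list unit, forall i, ~ In i l -> f i = rzero A.
Proof. exists [tt]. intros [] H. destruct H. now left. Qed.

Definition hval (h : H1) : A := proj1_sig h tt.
Definition hinj (a : A) : H1 := exist _ (fun _ => a) (unit_support _).

Lemma hval_ext (h k : H1) : hval h = hval k -> h = k.
Proof. intros H. apply sig_ext, functional_extensionality. intros []. exact H. Qed.

Lemma hval_mk (f : unit -> A) : hval (mk (H0 A unit) f) = f tt.
Proof. unfold hval. rewrite mkE; [easy|apply unit_support]. Qed.

Lemma hval_inj a : hval (hinj a) = a.
Proof. reflexivity. Qed.

Lemma hinj_val h : hinj (hval h) = h.
Proof. now apply hval_ext. Qed.

Definition hact (g : G) (h : H1) : H1 := mk (H0 A unit) (fun i => ract g (proj1_sig h i)).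

(** [H_A] for a one-point index set, that is, a copy of [A]; [hval] and [hinj] are the
    identification. *)
Definition HM : fmod A := Hmod hact.

Lemma hval_add (h k : HM) : hval (madd h k) = radd (hval h) (hval k).
Proof. apply hval_mk. Qed.
Lemma hval_zero : hval (mzero HM) = rzero A.
Proof. reflexivity. Qed.
Lemma hval_opp (h : HM) : hval (mopp h) = ropp (hval h).
Proof. apply (hval_mk (fun i => ropp (proj1_sig h i))). Qed.
Lemma hval_rac (h : HM) a : hval (mrac h a) = rmul (hval h) a.
Proof. apply (hval_mk (fun i => rmul (proj1_sig h i) a)). Qed.
Lemma hval_act g (h : HM) : hval (mS g h) = ract g (hval h).
Proof. apply hval_mk. Qed.

Lemma HM_theta (f : HM -> A) : mtheta f <-> exists a, f = fun h => rmul a (hval h).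
Proof using HA.
  split.
  - intros [l ->]. exists (lsum (radd (r:=A)) (rzero A) (map snd l)).
    apply functional_extensionality; intros h. induction l as [|[[] a] l IH]; unfold lsum in *; simpl.
    + now rewrite rmul0l.
    + now rewrite IH, rmulDl.
  - intros [a ->]. exists [(tt, a)]. apply functional_extensionality; intros h.
    unfold lsum; simpl. now rewrite radd0r.
Qed.

Global Instance HM_is_fmod : is_fmod HM.
Proof using HA.
  repeat apply conj; intros; try (apply hval_ext);
    do 2 rewrite ?hval_add, ?hval_zero, ?hval_opp, ?hval_rac, ?hval_act.
  - apply raddA.
  - apply raddC.
  - apply radd0l.
  - apply raddNl.
  - apply rmulDl.
  - apply rmulDr.
  - apply rmulA.
  - apply ractD.
  - apply ract1.
  - apply ractG.
  - apply ractM.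
  - apply HM_theta in H. destruct H as [c ->]. split; intros.
    + now rewrite hval_add, rmulDr.
    + now rewrite hval_rac, rmulA.
  - apply HM_theta. exists (rzero A). apply functional_extensionality; intros h. now rewrite rmul0l.
  - apply HM_theta in H, H0. destruct H as [c ->], H0 as [d ->]. apply HM_theta. exists (radd c d).
    apply functional_extensionality; intros h. now rewrite rmulDl.
  - apply HM_theta in H. destruct H as [c ->]. apply HM_theta. exists (rmul a c).
    apply functional_extensionality; intros h. apply rmulA.
  - apply HM_theta in H. destruct H as [c ->]. apply HM_theta. exists (ract g c).
    apply functional_extensionality; intros h. unfold thact. now rewrite ractM, hval_act, ractK.
Qed.

Lemma hinj_add a b : hinj (radd a b) = madd (f:=HM) (hinj a) (hinj b).
Proof. apply hval_ext. now rewrite hval_add. Qed.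
Lemma hinj_rac a b : hinj (rmul a b) = mrac (f:=HM) (hinj a) b.
Proof. apply hval_ext. now rewrite hval_rac. Qed.
Lemma hinj_zero : hinj (rzero A) = mzero HM.
Proof. now apply hval_ext. Qed.
Lemma hinj_act g a : hinj (ract g a) = mS (f:=HM) g (hinj a).
Proof. apply hval_ext. now rewrite hval_act. Qed.

Lemma HM_cofull : cofull HM.
Proof using HA QA.
  apply cofull_intro. intros P P0 PD PT h. rewrite <- (hinj_val h). generalize (hval h).
  apply (quadratik_ind QA).
  - now rewrite hinj_zero.
  - intros x y Hx Hy. rewrite hinj_add. now apply PD.
  (* A second splitting is required: a functional is itself a left multiplication, so the generators
     are triple products [x (y z)]. *)
  - intros x. apply (quadratik_ind QA).
    + now rewrite rmul0r, hinj_zero.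
    + intros y z Hy Hz. rewrite rmulDr, hinj_add. now apply PD.
    + intros y z. rewrite hinj_rac.
      exact (PT (hinj x) (hinj z) (exist _ _ (proj2 (HM_theta _) (ex_intro _ y eq_refl)))).
Qed.

(** For [a = x y] the map is [theta] of [x] and the functional [y v]. Only the multiples of [v], not
    [v] itself, are assumed to be functionals. *)
Lemma isKm_hinj {P : fmod A} (v : P -> A) (Hv : forall c, mtheta (fun z => rmul c (v z))) a :
  isKm (F:=HM) (fun z => hinj (rmul a (v z))).
Proof using HA QA.
  revert a. apply (quadratik_ind QA).
  - apply (isKm_ext (fun _ => mzero HM)); [|apply isKm_zero]. intros z. now rewrite rmul0l, hinj_zero.
  - intros x y Hx Hy. generalize (isKm_add _ _ Hx Hy). apply isKm_ext.
    intros z. now rewrite rmulDl, hinj_add.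
  - intros x y. generalize (isKm_theta (F:=HM) (hinj x) _ (Hv y)). apply isKm_ext.
    intros z. now rewrite <- rmulA, hinj_rac.
Qed.

Section Std.
Context {E : fmod A} {HE : is_fmod E} (CE : cofull E).

Definition std_corner : corner A :=
  @Corner G A E unit tt hact (Esum E HM) (fun x => x) (fun phi => phi).

Lemma std_corner_cofull : cofull (Esum E HM).
Proof using HA QA HE CE. apply Esum_cofull; [exact CE|exact HM_cofull]. Qed.

Lemma std_corner_valid : corner_valid std_corner.
Proof using HA QA HE CE.
  refine (conj HE (conj HM_is_fmod (conj _ (conj _ (conj _ (conj _ std_corner_cofull)))))).
  - intros g h. exact (hval_mk _).
  - intros g h h' _ [] H. now destruct H.
  - repeat apply conj; auto.
    + now exists (fun x => x).
    + now exists (fun x => x).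
Qed.

Lemma std_corner_obj : is_obj (Kring (cX std_corner)).
Proof using HA QA HE CE. exact (Kring_obj std_corner_cofull). Qed.

Lemma ecornerE a (x : Esum E HM) :
  proj1_sig (ecorner std_corner a) x = (mzero E, hinj (rmul a (hval (snd x)))).
Proof using HA QA HE.
  (* [ecorner] inverts [cU] by a choice; here [cU] is the identity, which forces the chosen
     value. *)
  assert (Heq : (fun xi : Esum E HM => epsilon (inhabits xi) (fun zeta => zeta = e0 (c:=std_corner) a xi))
     = (fun xi : Esum E HM => (mzero E, hinj (rmul a (hval (snd xi)))))).
  { apply functional_extensionality; intros xi.
    rewrite (epsilon_spec (inhabits xi) (fun zeta => zeta = e0 (c:=std_corner) a xi)); [|now eexists].
    unfold e0. simpl. f_equal. apply hval_ext. rewrite hval_mk.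
    now destruct (excluded_middle_informative (tt = tt)). }
  change (proj1_sig (mk (K0 (Esum E HM))
    (fun xi : Esum E HM => epsilon (inhabits xi) (fun zeta => zeta = e0 (c:=std_corner) a xi))) x
    = (mzero E, hinj (rmul a (hval (snd x))))).
  rewrite Heq, mkE; [easy|].
  apply (slot_isKm (P:=HM) (Q:=HM) (Z:=Esum E HM) _ _ _ _ slot_snd slot_snd (fun h : HM => hinj (rmul a (hval h)))).
  apply (isKm_hinj (P:=HM) hval). intros c. apply HM_theta. now exists c.
Qed.

Lemma ecorner_hom : is_hom (ecorner std_corner).
Proof using HA QA HE CE.
  repeat split; [intros a b|intros a b|intros g a]; apply KextE; intros [z h]; rewrite ecornerE.
  - rewrite KaddE, !ecornerE. simpl. rewrite madd0l. f_equal. now rewrite rmulDl, hinj_add.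
  - rewrite KmulE, !ecornerE. cbn [snd]. now rewrite hval_inj, rmulA.
  - rewrite KactE, ecornerE.
    change ((mzero E, hinj (rmul (ract g a) (hval h))) =
      (mS g (mzero E), mS (f:=HM) g (hinj (rmul a (hval (mS (f:=HM) (ginv G g) h)))))).
    now rewrite mS0, <- hinj_act, hval_act, ractM, ractK.
Qed.
End Std.
End Corner.

(** * Tensoring with functions on the unit interval, and rotation homotopies *)

Section ZTensor.
Context {G : group} {B : rdata G} {HB : is_ring B} {M : Type}.
Variables (add mul : M -> M -> M) (P : M -> Prop).

Notation rel := (tens_rel (B:=B) add P).
Notation cls := (ztcls (B:=B) add P).
Notation okl := (List.Forall (fun p : B * M => P (snd p))).

Lemma tens_rel_perm l l' : Permutation l l' -> rel l l'.
Proof.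
  induction 1.
  - apply tr_refl.
  - apply (tr_app (l1:=[x]) (l1':=[x])); [apply tr_refl|assumption].
  - apply (tr_app (l1:=[y; x]) (l1':=[x; y])); [apply (tr_swap add P [y] [x])|apply tr_refl].
  - eapply tr_trans; eassumption.
Qed.

Lemma ztcls_val l : okl l -> proj1_sig (cls l) = rel l.
Proof. intros H. unfold ztcls. apply mkE. now exists l. Qed.

Lemma ztcls_eq l l' : rel l l' -> cls l = cls l'.
Proof.
  intros H. unfold ztcls. f_equal. apply functional_extensionality; intros k.
  apply propositional_extensionality. split; intros K.
  - exact (tr_trans (tr_sym H) K).
  - exact (tr_trans H K).
Qed.

Lemma ztrep_spec (x : ztcar B add P) : okl (ztrep x) /\ proj1_sig x = rel (ztrep x).
Proof. unfold ztrep. apply epsilon_spec. exact (proj2_sig x). Qed.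

Lemma ztrep_cls l : okl l -> okl (ztrep (cls l)) /\ rel (ztrep (cls l)) l.
Proof.
  intros H. destruct (ztrep_spec (cls l)) as [H1 H2]. split; [exact H1|].
  rewrite (ztcls_val l H) in H2. apply tr_sym. rewrite H2. apply tr_refl.
Qed.

Notation Z := (ZTens B add mul P).

Lemma zadd_cls l l' : okl l -> okl l' -> radd (r:=Z) (cls l) (cls l') = cls (l ++ l').
Proof.
  intros H H'. simpl. apply ztcls_eq. apply tr_app; now apply ztrep_cls.
Qed.

Lemma tens_rel_map {M' : Type} (add' : M' -> M' -> M') (P' : M' -> Prop) (f : B -> B) (h : M -> M') :
  (forall m, P m -> P' (h m)) -> (forall m m', P m -> P m' -> h (add m m') = add' (h m) (h m')) ->
  f (rzero B) = rzero B -> (forall x y, f (radd x y) = radd (f x) (f y)) ->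
  forall l l', rel l l' ->
  tens_rel add' P' (map (fun p => (f (fst p), h (snd p))) l) (map (fun p => (f (fst p), h (snd p))) l').
Proof.
  intros HP hD f0 fD l l'. induction 1; rewrite ?map_app; simpl.
  - apply tr_refl.
  - now apply tr_sym.
  - eapply tr_trans; eassumption.
  - now apply tr_app.
  - apply tr_swap.
  - rewrite fD. apply tr_addl; auto.
  - rewrite hD by assumption. apply tr_addr; auto.
  - rewrite f0. apply tr_zero; auto.
Qed.

Lemma zact_cls g l : okl l -> ract (r:=Z) g (cls l) = cls (map (fun p => (ract g (fst p), snd p)) l).
Proof using HB.
  intros H. simpl. apply ztcls_eq. apply (tens_rel_map add P (ract g) (fun m => m)); auto.
  - apply ract0.
  - apply ractD.
  - now apply ztrep_cls.
Qed.

Lemma tens_rel_cons p l l' : rel l l' -> rel (p :: l) (p :: l').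
Proof. intros H. apply (tr_app (l1:=[p]) (l1':=[p])); [apply tr_refl|exact H]. Qed.

Lemma tens_rel_zero m l l' : P m -> rel l l' -> rel ((rzero B, m) :: l) l'.
Proof. intros Hm H. apply (tr_app (l1:=[(rzero B, m)]) (l1':=nil)); [now apply tr_zero|exact H]. Qed.

Lemma tens_rel_merge b m m' r l l' : P m -> P m' -> add m m' = r -> rel l l' ->
  rel ((b, m) :: (b, m') :: l) ((b, r) :: l').
Proof.
  intros Hm Hm' <- H. apply (tr_app (l1:=[(b, m); (b, m')]) (l1':=[(b, add m m')])); [|exact H].
  apply tr_sym. now apply tr_addr.
Qed.

(** [M] is given with an addition but no named zero, so a zero is recognised by [m + m = m]. Then
    [b (x) m] equals its double, and [-b (x) m] cancels one copy. *)
Lemma tens_rel_null b m l l' : P m -> add m m = m -> rel l l' -> rel ((b, m) :: l) l'.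
Proof using HB.
  intros Hm Hmm H. apply (tr_app (l1:=[(b, m)]) (l1':=nil)); [|exact H].
  assert (E : rel [(b, m); (ropp b, m)] nil).
  { apply (tr_trans (l2:=[(rzero B, m)])); [|now apply tr_zero].
    apply tr_sym. rewrite <- (raddNl b), raddC. now apply tr_addl. }
  apply (tr_trans (l2:=[(b, m); (b, m); (ropp b, m)])); [|apply (tr_trans (l2:=[(b, m); (ropp b, m)])); [|exact E]].
  - apply tens_rel_cons. now apply tr_sym.
  - apply tens_rel_merge; auto. apply tr_refl.
Qed.

Lemma tens_rel_addl {I : Type} (f g : I -> B) (h : I -> M) (Hh : forall i, P (h i)) (l : list I) :
  rel (map (fun i => (radd (f i) (g i), h i)) l)
      (map (fun i => (f i, h i)) l ++ map (fun i => (g i, h i)) l).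
Proof using.
  induction l as [|i l IH]; simpl; [apply tr_refl|].
  apply (tr_trans (l2:=[(f i, h i); (g i, h i)] ++ (map (fun i => (f i, h i)) l ++ map (fun i => (g i, h i)) l))).
  - apply (tr_app (l1:=[_])); [now apply tr_addl|exact IH].
  - apply tens_rel_perm. simpl. constructor. apply Permutation_middle.
Qed.

Hypothesis PM : forall m m', P m -> P m' -> P (mul m m').
Hypothesis mulDl : forall a b c, mul (add a b) c = add (mul a c) (mul b c).
Hypothesis mulDr : forall a b c, mul c (add a b) = add (mul c a) (mul c b).

Definition lmul (l k : list (B * M)) : list (B * M) :=
  flat_map (fun p => map (fun q => (rmul (fst p) (fst q), mul (snd p) (snd q))) k) l.

Lemma lmul_relr l k k' : okl l -> rel k k' -> rel (lmul l k) (lmul l k').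
Proof using HB PM mulDr.
  intros Hl Hk. induction Hl as [|p l Hp Hl IH]; simpl; [apply tr_refl|].
  apply tr_app; [|exact IH].
  apply (tens_rel_map add P (rmul (fst p)) (mul (snd p))); auto using rmul0r, rmulDr.
Qed.

Lemma lmul_nil_r l : lmul l nil = nil.
Proof. induction l; simpl; auto. Qed.

(** Listing the products by columns instead of rows lets well-definedness in the first factor be
    proved like that in the second. *)
Lemma lmul_swap l k :
  Permutation (lmul l k) (flat_map (fun q => map (fun p => (rmul (fst p) (fst q), mul (snd p) (snd q))) l) k).
Proof.
  induction k as [|q k IH]; simpl.
  - now rewrite lmul_nil_r.
  - rewrite <- IH. clear IH. induction l as [|p l IH]; simpl; [reflexivity|].
    constructor. rewrite IH. rewrite !app_assoc. apply Permutation_app_tail. apply Permutation_app_comm.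
Qed.

Lemma lmul_rell l l' k : okl k -> rel l l' -> rel (lmul l k) (lmul l' k).
Proof using HB PM mulDl.
  intros Hk Hl.
  eapply tr_trans; [apply tens_rel_perm, lmul_swap|].
  eapply tr_trans; [|apply tr_sym, tens_rel_perm, lmul_swap].
  induction Hk as [|q k Hq Hk IH]; simpl; [apply tr_refl|].
  apply tr_app; [|exact IH].
  apply (tens_rel_map add P (fun b => rmul b (fst q)) (fun m => mul m (snd q))); auto using rmul0l, rmulDl.
Qed.

Lemma zmul_cls l l' : okl l -> okl l' -> rmul (r:=Z) (cls l) (cls l') = cls (lmul l l').
Proof using HB PM mulDl mulDr.
  intros H H'. simpl. apply ztcls_eq.
  apply (tr_trans (l2:=lmul l (ztrep (cls l')))).
  - apply lmul_rell; now apply ztrep_cls.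
  - apply lmul_relr; [assumption|]. now apply ztrep_cls.
Qed.
End ZTensor.

(** * Continuous functions on the unit interval *)

Lemma cont01_RtoC (f : R -> R) : (forall t, continuous f t) -> cont01 (fun t => RtoC (f (proj1_sig t))).
Proof.
  intros Hf t eps Heps.
  destruct (proj1 (filterlim_locally f (f (proj1_sig t))) (Hf (proj1_sig t)) (mkposreal eps Heps)) as [d Hd].
  exists d. split; [apply cond_pos|]. intros s Hs.
  rewrite <- RtoC_minus, Cmod_R. exact (Hd (proj1_sig s) Hs).
Qed.

Lemma cont01_mult (f g : I01 -> C) : cont01 f -> cont01 g -> cont01 (fun t => Cmult (f t) (g t)).
Proof.
  intros Hf Hg t eps Heps.
  assert (K : forall h : I01 -> C, 0 < 1 + Cmod (h t)) by (intros h; generalize (Cmod_ge_0 (h t)); lra).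
  (* [a] bounds [f] within [d1] of [t], where [f] varies by less than 1; the summand 1 also keeps
     both divisors positive. *)
  set (a := 1 + Cmod (f t)) in *. set (b := 1 + Cmod (g t)) in *.
  pose proof (K f) as Ha. pose proof (K g) as Hb. fold a in Ha. fold b in Hb.
  destruct (Hf t 1 Rlt_0_1) as (d1 & P1 & H1).
  destruct (Hf t (eps / (2 * b))) as (d2 & P2 & H2); [apply Rdiv_lt_0_compat; lra|].
  destruct (Hg t (eps / (2 * a))) as (d3 & P3 & H3); [apply Rdiv_lt_0_compat; lra|].
  exists (Rmin d1 (Rmin d2 d3)). split; [repeat apply Rmin_glb_lt; assumption|].
  intros s Hs.
  specialize (H1 s (Rlt_le_trans _ _ _ Hs (Rmin_l _ _))).
  specialize (H2 s (Rlt_le_trans _ _ _ Hs (Rle_trans _ _ _ (Rmin_r _ _) (Rmin_l _ _)))).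
  specialize (H3 s (Rlt_le_trans _ _ _ Hs (Rle_trans _ _ _ (Rmin_r _ _) (Rmin_r _ _)))).
  replace (Cminus (Cmult (f s) (g s)) (Cmult (f t) (g t))) with
    (Cplus (Cmult (f s) (Cminus (g s) (g t))) (Cmult (Cminus (f s) (f t)) (g t))) by ring.
  eapply Rle_lt_trans; [apply Cmod_triangle|]. rewrite !Cmod_mult.
  assert (Hfs : Cmod (f s) <= a).
  { replace (f s) with (Cplus (f t) (Cminus (f s) (f t))) by ring.
    eapply Rle_trans; [apply Cmod_triangle|]. unfold a. lra. }
  assert (X1 : Cmod (f s) * Cmod (Cminus (g s) (g t)) <= a * Cmod (Cminus (g s) (g t))).
  { apply Rmult_le_compat_r; [apply Cmod_ge_0|exact Hfs]. }
  assert (X2 : a * Cmod (Cminus (g s) (g t)) < a * (eps / (2 * a))) by (apply Rmult_lt_compat_l; assumption).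
  assert (X3 : Cmod (Cminus (f s) (f t)) * Cmod (g t) <= eps / (2 * b) * b).
  { apply Rmult_le_compat; [apply Cmod_ge_0|apply Cmod_ge_0|lra|unfold b; lra]. }
  replace (a * (eps / (2 * a))) with (eps / 2) in X2 by (field; lra).
  replace (eps / (2 * b) * b) with (eps / 2) in X3 by (field; lra).
  lra.
Qed.

(** * Matrix units and the path between the two diagonal ones *)

Section Rotation.
Context {G : group} {D K : rdata G} {HD : is_ring D} {HK : is_ring K}.

(* The data of a ring homomorphism [M_2(D) -> K], given by its four entries. *)
Record matrix_units (F : bool -> bool -> D -> K) : Prop := MatrixUnits {
  mu_add : forall i j x y, F i j (radd x y) = radd (F i j x) (F i j y);
  mu_act : forall i j g x, F i j (ract g x) = ract g (F i j x);
  mu_mul : forall i j l x y, rmul (F i j x) (F j l y) = F i l (rmul x y);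
  mu_orth : forall i j k l x y, j <> k -> rmul (F i j x) (F k l y) = rzero K }.

(* Column [v] and row [w] with [w v = 1], so that [v w] is a path of idempotents
   in [M_2(Z[t])] joining the two diagonal matrix units. *)
Definition rot_v (i : bool) (t : R) : R := if i then 1 - t else t.
Definition rot_w (i : bool) (t : R) : R := if i then (1 - t) * (1 + 2 * t) else t * (3 - 2 * t).
Definition rot (p : bool * bool) (t : I01) : C :=
  RtoC (rot_v (fst p) (proj1_sig t) * rot_w (snd p) (proj1_sig t)).

Lemma rot_cont p : cont01 (rot p).
Proof.
  apply (cont01_RtoC (fun t => rot_v (fst p) t * rot_w (snd p) t)).
  intros t. apply (ex_derive_continuous (fun t => rot_v (fst p) t * rot_w (snd p) t)).
  destruct p as [[|] [|]]; unfold rot_v, rot_w; simpl; auto_derive; auto.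
Qed.

(** Summing over the middle index gives [w v = 1], which is the expansion of [((1-t) + t)^3], with
    the terms divisible by [(1-t)^2] and those divisible by [t^2] collected. The extra factors [1-t]
    and [t] in [w] make [v w] a matrix unit at both ends. *)
Lemma rot_mul i l t :
  Cplus (Cmult (rot (i, true) t) (rot (true, l) t)) (Cmult (rot (i, false) t) (rot (false, l) t)) = rot (i, l) t.
Proof.
  unfold rot. simpl. rewrite <- !RtoC_mult, <- RtoC_plus. f_equal. destruct i, l; unfold rot_v, rot_w; ring.
Qed.

(** The homotopy sends [d] to the sum of the [F i j d (x) v_i w_j]; it is multiplicative because
    [v w] is idempotent. *)
Lemma matrix_units_homotopic (F : bool -> bool -> D -> K) :
  matrix_units F -> homotopic (F true true) (F false false).
Proof using HK.
  intros [Fadd Fact Fmul Forth].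
  set (idx := [(true, true); (true, false); (false, true); (false, false)]).
  set (L := fun d => map (fun p : bool * bool => (F (fst p) (snd p) d, rot p)) idx).
  set (addf := fun (f g : I01 -> C) t => Cplus (f t) (g t)).
  assert (okL : forall d, List.Forall (fun p => cont01 (snd p)) (L d))
    by (intros d; repeat constructor; apply rot_cont).
  (* [evalt] uses a chosen representative; pointwise evaluation respects the tensor relations, so
     [L d] may be used instead. *)
  assert (ev : forall t d, evalt t (ztcls (B:=K) addf cont01 (L d)) =
     ztcls (B:=K) Cplus (fun _ => True) (map (fun p => (fst p, snd p t)) (L d))).
  { intros t d. unfold evalt. apply ztcls_eq.
    apply (tens_rel_map (B:=K) addf cont01 Cplus (fun _ => True) (fun b => b) (fun m : I01 -> C => m t)); auto.
    now apply ztrep_cls. }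
  exists (fun d => ztcls (B:=K) addf cont01 (L d)). split; [repeat split|split].
  - intros x y. unfold BC. rewrite zadd_cls by auto. apply ztcls_eq.
    generalize (tens_rel_addl addf cont01 (fun p => F (fst p) (snd p) x) (fun p => F (fst p) (snd p) y) rot rot_cont idx).
    unfold L, idx. simpl. now rewrite !Fadd.
  - intros x y. unfold BC. rewrite zmul_cls; auto.
    + apply ztcls_eq, tr_sym. unfold L, idx, lmul. simpl.
      rewrite !Fmul, !Forth by discriminate.
      assert (PM : forall p q, cont01 (fun t => Cmult (rot p t) (rot q t)))
        by (intros p q; apply cont01_mult; apply rot_cont).
      (* Of the sixteen products, the eight with different inner indices vanish. The others are then
         reordered so that the two with equal outer indices are adjacent and merge by [rot_mul]. *)
      eapply tr_trans; [repeat first [apply tens_rel_zero; [apply PM|] | apply tens_rel_cons | apply tr_refl]|].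
      match goal with |- tens_rel _ _ [?a; ?b; ?a'; ?b'; ?c; ?d; ?c'; ?d'] _ =>
        apply (tr_trans (l2:=[a; a'; b; b'; c; c'; d; d'])) end.
      * apply tens_rel_perm.
        match goal with |- Permutation [?a; ?b; ?a'; ?b'; ?c; ?d; ?c'; ?d'] _ =>
          exact (Permutation_app (perm_skip a (perm_swap a' b [b'])) (perm_skip c (perm_swap c' d [d']))) end.
      * repeat (apply tens_rel_merge; [apply PM|apply PM|apply functional_extensionality; intros t; apply rot_mul|]).
        apply tr_refl.
    + apply cont01_mult.
    + intros a b c. apply functional_extensionality; intros t. unfold addf. ring.
    + intros a b c. apply functional_extensionality; intros t. unfold addf. ring.
  - intros g x. unfold BC. rewrite zact_cls by auto. f_equal. unfold L. rewrite map_map.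
    apply map_ext. intros p. simpl. now rewrite Fact.
  - intros d. rewrite ev. unfold iotaC. apply ztcls_eq. unfold L, idx. simpl.
    (* At [t = 0] both [v] and [w] are [(1, 0)]: one coefficient is 1, and the other three are
       zeros, recognised by [0 + 0 = 0]. *)
    replace (rot (true, true) t0) with (RtoC 1) by (unfold rot, rot_v, rot_w; simpl; f_equal; ring).
    apply tens_rel_cons.
    repeat (apply tens_rel_null; [exact I|unfold rot, rot_v, rot_w; simpl; rewrite <- RtoC_plus; f_equal; ring|]).
    apply tr_refl.
  - intros d. rewrite ev. unfold iotaC. apply ztcls_eq. unfold L, idx. simpl.
    replace (rot (false, false) t1) with (RtoC 1) by (unfold rot, rot_v, rot_w; simpl; f_equal; ring).
    do 3 (apply tens_rel_null; [exact I|unfold rot, rot_v, rot_w; simpl; rewrite <- RtoC_plus; f_equal; ring|]).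
    apply tr_refl.
Qed.
End Rotation.

(** * Composing the two morphisms *)

Section Blocks.
Context {G : group} {D A : rdata G} {HA : is_ring A}.
Context {Z : fmod A} {HZ : is_fmod Z} (P : bool -> fmod A) {HP : forall i, is_fmod (P i)}.
Variables (inj : forall i, P i -> Z) (prj : forall i, Z -> P i).
Hypothesis Hslot : forall i, slot (P i) Z (inj i) (prj i).
Hypothesis Horth : forall i j, i <> j -> forall x, prj j (inj i x) = mzero (P j).
Variable op : forall i j : bool, D -> P j -> P i.
Hypothesis op_isKm : forall i j d, isKm (op i j d).
Hypothesis op_add : forall i j d e x, op i j (radd d e) x = madd (op i j d x) (op i j e x).
Hypothesis op_act : forall i j g d x, op i j (ract g d) x = mS g (op i j d (mS (ginv G g) x)).
Hypothesis op_mul : forall i j l d e x, op i j d (op j l e x) = op i l (rmul d e) x.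

Definition block (i j : bool) (d : D) : Kring Z := mk (K0 Z) (fun z => inj i (op i j d (prj j z))).

Lemma blockE i j d z : proj1_sig (block i j d) z = inj i (op i j d (prj j z)).
Proof using HP HZ Hslot op_isKm.
  unfold block. rewrite mkE; [easy|]. exact (slot_isKm _ _ _ _ (Hslot j) (Hslot i) _ (op_isKm i j d)).
Qed.

(** The common form of both homotopies: operators between two orthogonal summands of [Z], indexed by
    [D] and multiplying like matrix units, become matrix units in [K(Z)]. *)
Lemma block_homotopic : homotopic (block true true) (block false false).
Proof using HA HP HZ Hslot Horth op_isKm op_add op_act op_mul.
  apply (matrix_units_homotopic (K:=Kring Z) block). split.
  - intros i j x y. apply KextE; intros z. rewrite KaddE, !blockE, op_add. apply (slot_im _ _ _ _ (Hslot i)).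
  - intros i j g x. apply KextE; intros z.
    now rewrite KactE, !blockE, op_act, (slot_ie _ _ _ _ (Hslot i)), (slot_pe _ _ _ _ (Hslot j)).
  - intros i j l x y. apply KextE; intros z.
    now rewrite KmulE, !blockE, (slot_pi _ _ _ _ (Hslot j)), op_mul.
  - intros i j k l x y Hjk. apply KextE; intros z.
    rewrite KmulE, !blockE, Horth by auto.
    rewrite (mod_map0 _ (isKm_mod_map _ (op_isKm i j x))). apply mod_map0. apply (slot_im _ _ _ _ (Hslot i)).
Qed.
End Blocks.

Lemma slot_Esum {G : group} {A : rdata G} {E E' H : fmod A} {HH : is_fmod H} i p :
  slot E E' i p -> slot (Esum E H) (Esum E' H) (fun x => (i (fst x), snd x)) (fun x => (p (fst x), snd x)).
Proof.
  intros [im ie it pm pe pt pi]. split.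
  - split; intros; simpl; [now rewrite (proj1 im)|now rewrite (proj2 im)].
  - intros g x. simpl. now rewrite ie.
  - intros c (phi & psi & Hphi & Hpsi & ->). exists (fun x => phi (i x)), psi.
    repeat split; [now apply it|easy].
  - split; intros; simpl; [now rewrite (proj1 pm)|now rewrite (proj2 pm)].
  - intros g x. simpl. now rewrite pe.
  - intros c (phi & psi & Hphi & Hpsi & ->). exists (fun x => phi (p x)), psi.
    repeat split; [now apply pt|easy].
  - intros [x h]. simpl. now rewrite pi.
Qed.

Lemma is_hom_comp {G : group} {A B C : rdata G} (f : A -> B) (h : B -> C) :
  is_hom f -> is_hom h -> is_hom (fun x => h (f x)).
Proof.
  intros (f1 & f2 & f3) (h1 & h2 & h3). repeat split; intros; [now rewrite f1, h1|now rewrite f2, h2|now rewrite f3, h3].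
Qed.

Definition corner_incl {G : group} {A B : rdata G} {E : fmod B} (m : A -> Kring E) (a : A) : Kring (Esum E (HM (A:=B))) :=
  Kmap (fun x : E => (x, mzero (HM (A:=B))) : Esum E HM) fst (m a).

Lemma corner_incl_hom {G : group} {A B : rdata G} {HB : is_ring B} {E : fmod B} {HE : is_fmod E}
  (m : A -> Kring E) (Hm : is_hom m) : is_hom (corner_incl m).
Proof. exact (is_hom_comp _ _ Hm (Kmap_hom _ _ slot_fst)). Qed.

(** * The modules and homomorphisms behind the composite [A -> B -> A] *)

Section Composite.
Context {G : group} {A B : rdata G} {HA : is_ring A} {HB : is_ring B}.
Context (QA : quadratik A) (QB : quadratik B).
Context {E : fmod B} {F : fmod A} {HE : is_fmod E} {HF : is_fmod F} (CE : cofull E) (CF : cofull F).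
Context (m : A -> Kring E) (n : B -> Kring F) (Hm : is_hom m) (Hn : is_hom n).

Notation pi := (fun b => proj1_sig (n b)).
Notation HMA := (HM (A:=A)).
Notation HMB := (HM (A:=B)).

Definition EB : fmod B := Esum E HMB.
Definition EBF : fmod A := tensor EB pi.
(** [corner_widen] uses the first and last summands, [corner_tensor] the middle one, and the last
    one is the distinguished copy of [A] for [eZ]. *)
Definition FEBFA : fmod A := Esum (Esum F EBF) HMA.

Local Instance EBF_is_fmod : is_fmod EBF := tensor_is_fmod n Hn.
Lemma EB_cofull : cofull EB.
Proof using HE HB CE QB. exact (std_corner_cofull QB CE). Qed.
Lemma EBF_cofull : cofull EBF.
Proof using HE HA HB CE QB HF Hn. exact (tensor_cofull n Hn EB_cofull). Qed.
Lemma F_EBF_cofull : cofull (Esum F EBF).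
Proof using HE HA HB CE QB HF Hn CF. exact (Esum_cofull CF EBF_cofull). Qed.

Definition eB : B -> Kring EB := ecorner (std_corner (E:=E)).
Definition eA : A -> Kring (Esum F HMA) := ecorner (std_corner (E:=F)).
Definition eZ : A -> Kring FEBFA := ecorner (std_corner (E:=Esum F EBF)).
Definition corner_widen : Kring (Esum F HMA) -> Kring FEBFA :=
  Kmap (P:=Esum F HMA) (Z:=FEBFA) (fun x => ((fst x, mzero EBF), snd x)) (fun x => (fst (fst x), snd x)).
Definition iT : EBF -> FEBFA := fun z => ((mzero F, z), mzero HMA).
Definition pT : FEBFA -> EBF := fun z => snd (fst z).
Definition corner_tensor : Kring EB -> Kring FEBFA := fun S => Kmap iT pT (Ktensor n EB S).

Lemma slot_T : slot EBF FEBFA iT pT.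
Proof using HA HB HF HE Hn. exact (slot_comp _ _ _ _ (slot_snd (E:=F) (H:=EBF)) (slot_fst (E:=Esum F EBF) (H:=HMA))). Qed.

Lemma slot_F : slot F FEBFA (fun y => ((y, mzero EBF), mzero HMA)) (fun z => fst (fst z)).
Proof using HA HB HF HE Hn. exact (slot_comp _ _ _ _ (slot_fst (E:=F) (H:=EBF)) (slot_fst (E:=Esum F EBF) (H:=HMA))). Qed.

Lemma slot_H : slot HMA FEBFA (fun y => (mzero (Esum F EBF), y)) snd.
Proof using HA HB HF HE Hn. exact slot_snd. Qed.

Lemma slot_J : slot (Esum F HMA) FEBFA (fun x => ((fst x, mzero EBF), snd x)) (fun x => (fst (fst x), snd x)).
Proof using HA HB HF HE Hn. exact (slot_Esum _ _ (slot_fst (E:=F) (H:=EBF))). Qed.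

Lemma corner_widen_hom : is_hom corner_widen.
Proof using HA HB HF HE Hn. exact (Kmap_hom _ _ slot_J). Qed.
Lemma Ktensor_EB_hom : is_hom (Ktensor n EB).
Proof using HE HA HB CE QB HF Hn. exact (Ktensor_hom n Hn EB_cofull). Qed.
Lemma corner_tensor_hom : is_hom corner_tensor.
Proof using HE HA HB CE QB HF Hn. exact (is_hom_comp _ _ Ktensor_EB_hom (Kmap_hom _ _ slot_T)). Qed.
Lemma eA_hom : is_hom eA. Proof using HA QA HF CF. exact (ecorner_hom QA CF). Qed.
Lemma eB_hom : is_hom eB. Proof using HB QB HE CE. exact (ecorner_hom QB CE). Qed.
Lemma eZ_hom : is_hom eZ. Proof using HA HB QA HF CF HE CE QB Hn. exact (ecorner_hom QA F_EBF_cofull). Qed.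

Lemma eZE a z : proj1_sig (eZ a) z = (mzero (Esum F EBF), hinj (rmul a (hval (snd z)))).
Proof using HA HB QA HF HE Hn. exact (ecornerE QA a z). Qed.

Lemma eAE a z : proj1_sig (eA a) z = (mzero F, hinj (rmul a (hval (snd z)))).
Proof using HA QA HF. exact (ecornerE QA a z). Qed.

Lemma eBE b z : proj1_sig (eB b) z = (mzero E, hinj (rmul b (hval (snd z)))).
Proof using HB QB HE. exact (ecornerE QB b z). Qed.

Lemma eA_corner_widen a : corner_widen (eA a) = eZ a.
Proof using HA HB QA HF HE Hn.
  apply KextE; intros z. rewrite eZE. unfold corner_widen. rewrite (KmapE _ _ slot_J).
  now rewrite eAE.
Qed.

(** * The homotopy between [n] and [e (x) 1] *)

Section CornerB.

Lemma phi_pull b : mtheta (f:=EB) (fun x => rmul b (hval (snd x))).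
Proof using HB HE.
  apply (slot_pt _ _ _ _ (slot_snd (E:=E) (H:=HMB)) (fun h => rmul b (hval h))). apply HM_theta. now exists b.
Qed.

Definition phiB (b : B) : Th EB := exist _ _ (phi_pull b).
Definition inB (b : B) : EB := (mzero E, hinj b).

Lemma inB_rac b c : inB (rmul b c) = mrac (f:=EB) (inB b) c.
Proof using HB HE. unfold inB. simpl. now rewrite mrac0l, hinj_rac. Qed.

Lemma inB_add b c : inB (radd b c) = madd (f:=EB) (inB b) (inB c).
Proof using HB HE. unfold inB. simpl. now rewrite madd0l, hinj_add. Qed.

Lemma inB_act g b : inB (ract g b) = mS (f:=EB) g (inB b).
Proof using HB HE. unfold inB. simpl. now rewrite mS0, hinj_act. Qed.

Definition PB (i : bool) : fmod A := if i then F else EBF.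
(** On [(x, b') (x) y] with [(x, b')] in [E (+) B], evaluation at [phiB b] gives [n(b b') y], so the
    entry towards [F] sees only the summand [B]. *)
Definition opB (i j : bool) : B -> PB j -> PB i :=
  match i, j return B -> PB j -> PB i with
  | true, true => fun b y => pi b y
  | true, false => fun b z => tval n z (phiB b)
  | false, true => fun b y => pure n (inB b) y
  | false, false => fun b z => proj1_sig (Ktensor n EB (eB b)) z
  end.
Definition injB (i : bool) : PB i -> FEBFA :=
  match i with true => fun y => ((y, mzero EBF), mzero HMA) | false => iT end.
Definition prjB (i : bool) : FEBFA -> PB i :=
  match i with true => fun z => fst (fst z) | false => pT end.

(** For a product, [phiB (b c)] is [b] times [phiB c], which supplies the factor [n(b)] that
    [tval_isKm] asks for. *)
Lemma isKm_tval_phiB b : isKm (E:=EBF) (F:=F) (fun z => tval n z (phiB b)).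
Proof using HA HB HF HE Hn QB.
  revert b. apply (quadratik_ind QB).
  - apply (isKm_ext (fun _ => mzero F)); [|apply isKm_zero]. intros z. symmetry.
    apply (tval_phi_zero n Hn). intros x. apply rmul0l.
  - intros b c Hb Hc. generalize (isKm_add _ _ Hb Hc). apply isKm_ext. intros z. symmetry.
    apply (tval_phi_add n Hn). intros x. apply rmulDl.
  - intros b c. apply (tval_isKm n Hn b (phiB c)). intros x. symmetry. apply rmulA.
Qed.

Lemma incl_Ktensor_homotopic : homotopic (fun b => corner_widen (corner_incl n b)) (fun b => corner_tensor (eB b)).
Proof using HA HB HF HE Hn QB CE.
  assert (HP : forall i, is_fmod (PB i)) by (intros [|]; typeclasses eauto).
  assert (Hs : forall i, slot (PB i) FEBFA (injB i) (prjB i)) by (intros [|]; [exact slot_F|exact slot_T]).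
  assert (Hk : forall i j b, isKm (opB i j b)).
  { intros [|] [|] b; simpl.
    - apply K_isKm.
    - apply isKm_tval_phiB.
    - apply (pure_isKm n Hn EB_cofull).
    - exact (K_isKm (Ktensor n EB (eB b))). }
  assert (Kmu : forall b x y, proj1_sig (Ktensor n EB (eB b)) (pure n x y) = pure n (proj1_sig (eB b) x) y).
  { intros b x y. rewrite (KtensorE n Hn EB_cofull). apply tmap_pure, K_pulls. }
  replace (fun b => corner_widen (corner_incl n b)) with (block PB injB prjB opB true true).
  replace (fun b => corner_tensor (eB b)) with (block PB injB prjB opB false false).
  apply block_homotopic; auto.
  - intros [|] [|] H x; try easy.
  - intros [|] [|] b c x; simpl opB.
    + apply (pi_add n Hn).
    + apply (tval_phi_add n Hn). intros t. apply rmulDl.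
    + rewrite inB_add. apply (pure_addl n Hn).
    + destruct eB_hom as (H & _ & _). rewrite H. destruct Ktensor_EB_hom as (H' & _ & _). rewrite H'.
      exact (KaddE (E:=EBF) (Ktensor n EB (eB b)) (Ktensor n EB (eB c)) x).
  - intros [|] [|] g b x; simpl opB.
    + destruct Hn as (_ & _ & H). rewrite H. apply KactE.
    + change (tval n x (phiB (ract g b)) = mS (f:=F) g (tval n (mS (f:=tensor EB pi) (ginv G g) x) (phiB b))).
      rewrite (tval_act n Hn), mSK. apply tval_phi_ext. intros t.
      change (rmul (ract g b) (hval (snd t)) =
        ract (ginv G (ginv G g)) (rmul b (hval (mS (f:=HMB) (ginv G (ginv G (ginv G g))) (snd t))))).
      now rewrite !ginvK, hval_act, ractM, ractK.
    + change (pure n (inB (ract g b)) x = mS (f:=tensor EB pi) g (pure n (inB b) (mS (ginv G g) x))).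
      now rewrite inB_act, (pure_act n Hn), mSK.
    + destruct eB_hom as (_ & _ & H). rewrite H. destruct Ktensor_EB_hom as (_ & _ & H'). rewrite H'.
      exact (KactE (E:=EBF) g (Ktensor n EB (eB b)) x).
  - intros [|] [|] [|] b c x; simpl opB.
    + symmetry. apply (pi_mul n Hn).
    + symmetry. apply (tval_phi_mul n Hn). intros t. symmetry. apply rmulA.
    + exact (tval_pure n (X:=EB) (inB c) x (phiB b)).
    + rewrite (KtensorE n Hn EB_cofull), (tval_tmap n _ (K_pulls _)). apply tval_phi_ext. intros t.
      cbn [Th_comp phiB proj1_sig]. rewrite eBE. cbn [snd]. rewrite hval_inj. apply rmulA.
    + rewrite inB_rac. symmetry. apply (pure_balanced n Hn).
    (* The decisive product: [e(b c)] is the operator [theta] of [inB b] and [phiB c], so going to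
       [F] and back is [e(b c) (x) 1]. *)
    + apply tval_ext; intros phi. rewrite (tval_pure n).
      rewrite (KtensorE n Hn EB_cofull), (tval_tmap n _ (K_pulls _)). symmetry.
      apply (tval_phi_mul n Hn). intros t. cbn [Th_comp phiB proj1_sig].
      rewrite eBE, <- rmulA.
      change (proj1_sig phi (inB (rmul b (rmul c (hval (snd t)))))
        = rmul (proj1_sig phi (inB b)) (rmul c (hval (snd t)))).
      rewrite inB_rac. apply (mthZ _ (proj2_sig phi)).
    + rewrite Kmu, eBE. reflexivity.
    + destruct eB_hom as (_ & H & _). rewrite H. destruct Ktensor_EB_hom as (_ & H' & _). rewrite H'.
      exact (eq_sym (KmulE (E:=EBF) (Ktensor n EB (eB b)) (Ktensor n EB (eB c)) x)).
  - apply functional_extensionality; intros b. apply KextE; intros z.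
    rewrite (blockE _ _ _ Hs _ Hk). unfold corner_tensor. now rewrite (KmapE _ _ slot_T).
  - apply functional_extensionality; intros b. apply KextE; intros z.
    rewrite (blockE _ _ _ Hs _ Hk). unfold corner_widen. rewrite (KmapE _ _ slot_J).
    unfold corner_incl. now rewrite (KmapE _ _ slot_fst).
Qed.
End CornerB.

(** * The homotopy between [m (x) 1] and the corner embedding of [A] *)

Section CornerA.
Notation EF := (tensor E pi).
Variables (X : EF -> Aself A) (f : Th EF -> Th (Aself A)).
Hypothesis HX : fiso_bi (A':=A) (E:=EF) (F:=Aself A)
  (tlact (pi:=pi) (fun a xi => proj1_sig (m a) xi)) (fun a x => rmul a x) X f.

Lemma X_add x y : X (madd x y) = radd (r:=A) (X x) (X y).
Proof using HX. apply HX. Qed.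
Lemma X_rac x a : X (mrac x a) = rmul (r:=A) (X x) a.
Proof using HX. apply HX. Qed.
Lemma X_act g x : X (mS g x) = ract (r:=A) g (X x).
Proof using HX. apply HX. Qed.
Lemma X_left a x : X (tmap n (proj1_sig (m a)) x) = rmul (r:=A) a (X x).
Proof using HX. apply HX. Qed.
Lemma X_inj x y : X x = X y -> x = y.
Proof using HX. destruct HX as (((Y & YX & XY) & _) & _). intros H. now rewrite <- (YX x), H. Qed.
Lemma X_inverse : exists Y : A -> EF, forall a, X (Y a) = a.
Proof using HX. destruct HX as (((Y & YX & XY) & _) & _). now exists Y. Qed.
(** This is where the functional half of the isomorphism enters: the inverse of [f] carries left
    multiplication by [c] to a functional of [E (x)_n F], and compatibility of [f] with [X] computes
    it. *)
Lemma X_theta c : mtheta (f:=EF) (fun z => rmul (r:=A) c (X z)).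
Proof using HX.
  destruct HX as ((_ & _ & _ & _ & (k & _ & fk) & _ & _ & _ & fX) & _).
  set (psi := exist _ (fun x : A => rmul (r:=A) c x) (ex_intro _ c eq_refl) : Th (Aself A)).
  replace (fun z => rmul (r:=A) c (X z)) with (proj1_sig (k psi)); [apply proj2_sig|].
  apply functional_extensionality; intros z. rewrite <- fX, fk. reflexivity.
Qed.

Notation sE := (slot_fst (E:=E) (H:=HMB)).
Notation iE := (tmap n (X:=E) (Y:=EB) (fun x : E => (x, mzero HMB))).
Notation pE := (tmap n (X:=EB) (Y:=E) (@fst E HMB)).

Lemma slot_E : slot EF EBF iE pE.
Proof using HA HB HF HE Hn. exact (tmap_slot n Hn _ _ sE). Qed.

(** [EBF] contains a copy of [A] through [E (x)_n F], on which [m(a) (x) 1] is left multiplication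
    by [a]; the last summand of [FEBFA] is a second copy, carrying [eZ]. Left multiplications
    between the two copies are the matrix units. *)
Lemma Ktensor_incl_homotopic : homotopic (fun a => corner_tensor (corner_incl m a)) eZ.
Proof using HA HB QA HF HE Hn QB CE HX.
  destruct X_inverse as [Y XY].
  assert (YX : forall x, Y (X x) = x) by (intros x; apply X_inj, XY).
  assert (YD : forall a b, Y (radd a b) = madd (f:=EF) (Y a) (Y b)) by (intros a b; apply X_inj; now rewrite X_add, !XY).
  assert (YZ : forall a b, Y (rmul a b) = mrac (f:=EF) (Y a) b) by (intros a b; apply X_inj; now rewrite X_rac, !XY).
  assert (YS : forall g a, Y (ract g a) = mS (f:=EF) g (Y a)) by (intros g a; apply X_inj; now rewrite X_act, !XY).
  pose (u := fun a : A => iE (Y a) : EBF). pose (v := fun z : EBF => X (pE z) : A).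
  assert (vu : forall a, v (u a) = a) by (intros a; unfold v, u; now rewrite (slot_pi _ _ _ _ slot_E)).
  assert (uD : forall a b, u (radd a b) = madd (f:=EBF) (u a) (u b)).
  { intros a b. unfold u. rewrite YD. apply (slot_im _ _ _ _ slot_E). }
  assert (uZ : forall a b, u (rmul a b) = mrac (f:=EBF) (u a) b).
  { intros a b. unfold u. rewrite YZ. apply (slot_im _ _ _ _ slot_E). }
  assert (uS : forall g a, u (ract g a) = mS (f:=EBF) g (u a)).
  { intros g a. unfold u. rewrite YS. apply (slot_ie _ _ _ _ slot_E). }
  assert (vS : forall g z, v (mS (f:=EBF) g z) = ract g (v z)).
  { intros g z. unfold v. rewrite <- X_act. f_equal. apply (slot_pe _ _ _ _ slot_E). }
  assert (vT : forall c, mtheta (f:=EBF) (fun z => rmul c (v z))).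
  { intros c. exact (slot_pt _ _ _ _ slot_E _ (X_theta c)). }
  (* [corner_incl m a] lives on the summand [E], so its tensor with 1 factors through [E (x)_n F],
     where [X] intertwines it with multiplication by [a]. *)
  assert (Ku : forall a z, proj1_sig (Ktensor n EB (corner_incl m a)) z = u (rmul a (v z))).
  { intros a z. unfold u, v. rewrite <- X_left, YX, (KtensorE n Hn EB_cofull).
    apply tval_ext; intros phi. rewrite (tval_tmap n _ (K_pulls _)).
    rewrite (tval_tmap n _ (slot_it _ _ _ _ sE)), (tval_tmap n _ (K_pulls _)), (tval_tmap n _ (slot_pt _ _ _ _ sE)).
    apply tval_phi_ext. intros t. cbn [Th_comp proj1_sig]. unfold corner_incl. now rewrite (KmapE _ _ sE). }
  pose (P := fun i : bool => if i then EBF else HMA).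
  pose (into := fun i : bool => match i return A -> P i with true => u | false => hinj end).
  pose (out := fun i : bool => match i return P i -> A with true => v | false => hval end).
  pose (op := fun (i j : bool) (a : A) (x : P j) => into i (rmul a (out j x))).
  pose (inj := fun i : bool => match i return P i -> FEBFA with
    true => iT | false => fun y => (mzero (Esum F EBF), y) end).
  pose (prj := fun i : bool => match i return FEBFA -> P i with true => pT | false => snd end).
  assert (HP : forall i, is_fmod (P i)) by (intros [|]; simpl; typeclasses eauto).
  assert (Hs : forall i, slot (P i) FEBFA (inj i) (prj i)) by (intros [|]; [exact slot_T|exact slot_H]).
  assert (inD : forall i a b, into i (radd a b) = madd (into i a) (into i b)).
  { intros [|] a b; [apply uD|apply hinj_add]. }
  assert (inZ : forall i a b, into i (rmul a b) = mrac (into i a) b).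
  { intros [|] a b; [apply uZ|apply hinj_rac]. }
  assert (inS : forall i g a, into i (ract g a) = mS g (into i a)).
  { intros [|] g a; [apply uS|apply hinj_act]. }
  assert (outS : forall i g x, out i (mS g x) = ract g (out i x)).
  { intros [|] g a; [apply vS|apply hval_act]. }
  assert (outT : forall i c, mtheta (fun x => rmul c (out i x))).
  { intros [|] c; [apply vT|apply HM_theta; now exists c]. }
  assert (outin : forall i a, out i (into i a) = a).
  { intros [|] a; [apply vu|apply hval_inj]. }
  assert (Hk : forall i j a, isKm (op i j a)).
  { intros i j. apply (quadratik_ind QA).
    - apply (isKm_ext (fun _ => mzero (P i))); [|apply isKm_zero]. intros x. unfold op.
      symmetry. apply madd_idem. now rewrite rmul0l, <- inD, radd0l.
    - intros a b Ha Hb. generalize (isKm_add _ _ Ha Hb). apply isKm_ext. intros x. unfold op.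
      now rewrite rmulDl, inD.
    (* For a product [a b] the entry is [theta] of [into i a] and the functional [b] times
       [out j]. *)
    - intros a b. generalize (isKm_theta (into i a) _ (outT j b)). apply isKm_ext. intros x. unfold op.
      now rewrite <- rmulA, inZ. }
  replace (fun a => corner_tensor (corner_incl m a)) with (block P inj prj op true true).
  replace eZ with (block P inj prj op false false).
  apply block_homotopic; auto.
  - intros [|] [|] H x; easy.
  - intros i j a b x. unfold op. now rewrite rmulDl, inD.
  - intros i j g a x. unfold op. now rewrite <- inS, ractM, outS, ractK.
  - intros i j l a b x. unfold op. now rewrite outin, rmulA.
  - apply functional_extensionality; intros a. apply KextE; intros z.
    rewrite (blockE _ _ _ Hs _ Hk). now rewrite eZE.
  - apply functional_extensionality; intros a. apply KextE; intros z.
    rewrite (blockE _ _ _ Hs _ Hk). unfold corner_tensor. now rewrite (KmapE _ _ slot_T), Ku.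
Qed.
End CornerA.
End Composite.

(** * Computation in the category *)

Section Category.
Context {G : group}.

Global Instance gk_eq_equiv (A B : Obj G) : Equivalence (@gk_eq G A B).
Proof. split; red; intros; [apply ge_refl|now apply ge_sym|eapply ge_trans; eassumption]. Qed.

Global Instance tComp_proper (A B C : Obj G) : Proper (@gk_eq G A B ==> @gk_eq G B C ==> @gk_eq G A C) (@tComp G A B C).
Proof. intros x x' Hx y y' Hy. now apply ge_comp. Qed.

(** From [eA; J = eZ] and the invertibility of both embeddings, [iA = J; iZ]. Then [y; J] is
    replaced by [eB; N], [iB; eB] cancels, and [x; N; iZ = eZ; iZ = 1] remains. *)
Lemma corner_diagram {A B KA KB KZ : Obj G}
  (x : term A KB) (eB : term B KB) (iB : term KB B) (y : term B KA) (eA : term A KA) (iA : term KA A)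
  (N : term KB KZ) (J : term KA KZ) (eZ : term A KZ) (iZ : term KZ A) :
  gk_eq (tComp iB eB) (tId KB) -> gk_eq (tComp iA eA) (tId KA) -> gk_eq (tComp eZ iZ) (tId A) ->
  gk_eq (tComp eA J) eZ -> gk_eq (tComp y J) (tComp eB N) -> gk_eq (tComp x N) eZ ->
  gk_eq (tComp (tComp x iB) (tComp y iA)) (tId A).
Proof.
  intros HB HA HZ HJ Hy Hx.
  assert (H : gk_eq iA (tComp J iZ)).
  { rewrite <- (ge_idl (tComp J iZ)), <- HA, <- ge_compA, (ge_compA eA J iZ), HJ, HZ. symmetry. apply ge_idr. }
  rewrite H, <- ge_compA, (ge_compA y J iZ), Hy, <- (ge_compA eB N iZ), (ge_compA iB eB), HB, ge_idl, ge_compA, Hx.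
  exact HZ.
Qed.

Lemma tHom_ext (A B : Obj G) (f h : ocar A -> ocar B) Hf Hh :
  (forall x, f x = h x) -> gk_eq (tHom (f:=f) Hf) (tHom (f:=h) Hh).
Proof.
  intros H. assert (f = h) as -> by now apply functional_extensionality.
  rewrite (proof_irrelevance _ Hf Hh). apply ge_refl.
Qed.
End Category.

Lemma morita_composite_id {G : group} (A B : Obj G) {HA : is_ring (ocar A)} {HB : is_ring (ocar B)}
  (QA : quadratik (ocar A)) (QB : quadratik (ocar B))
  {E : fmod (ocar B)} {F : fmod (ocar A)} {HE : is_fmod E} {HF : is_fmod F} (CE : cofull E) (CF : cofull F)
  (m : ocar A -> Kring E) (n : ocar B -> Kring F) (Hm : is_hom m) (Hn : is_hom n)
  (X : tensor E (fun b => proj1_sig (n b)) -> Aself (ocar A))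
  (f : Th (tensor E (fun b => proj1_sig (n b))) -> Th (Aself (ocar A))) :
  fiso_bi (A':=ocar A) (E:=tensor E (fun b => proj1_sig (n b))) (F:=Aself (ocar A))
    (tlact (pi:=fun b => proj1_sig (n b)) (fun a xi => proj1_sig (m a) xi)) (fun a x => rmul a x) X f ->
  gk_eq (tComp (tComp (tHom (A:=A) (B:=Kobj (std_corner_obj QB CE)) (corner_incl_hom m Hm))
                      (tEinv (std_corner_valid QB CE) (std_corner_obj QB CE)))
               (tComp (tHom (A:=B) (B:=Kobj (std_corner_obj QA CF)) (corner_incl_hom n Hn))
                      (tEinv (std_corner_valid QA CF) (std_corner_obj QA CF))))
        (tId A).
Proof.
  intros HX.
  pose proof (EBF_is_fmod (E:=E) n Hn) as HT.
  pose (CZ := F_EBF_cofull (E:=E) QB CE CF n Hn).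
  pose (KZ := Kobj (std_corner_obj QA CZ)).
  pose (KA := Kobj (std_corner_obj QA CF)).
  pose (KB := Kobj (std_corner_obj QB CE)).
  pose proof (corner_tensor_hom QB CE n Hn) as HN. pose proof (corner_widen_hom (E:=E) n Hn) as HJ.
  pose proof (eA_hom QA CF) as HeA. pose proof (eB_hom QB CE) as HeB. pose proof (eZ_hom QA QB CE CF n Hn) as HeZ.
  apply (corner_diagram (KZ:=KZ) _ (tHom (A:=B) (B:=KB) HeB) _ _ (tHom (A:=A) (B:=KA) HeA) _
    (tHom (A:=KB) (B:=KZ) HN) (tHom (A:=KA) (B:=KZ) HJ) (tHom (A:=A) (B:=KZ) HeZ)
    (tEinv (A:=A) (std_corner_valid QA CZ) (std_corner_obj QA CZ))).
  - apply (ge_corner2 (A:=B)).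
  - apply (ge_corner2 (A:=A)).
  - apply (ge_corner1 (A:=A)).
  - refine (ge_trans (ge_homcomp (A:=A) (B:=KA) (C:=KZ) HeA HJ (is_hom_comp _ _ HeA HJ)) _).
    apply tHom_ext. intros a. apply (eA_corner_widen QA n Hn).
  - refine (ge_trans (ge_homcomp (A:=B) (B:=KA) (C:=KZ) (corner_incl_hom n Hn) HJ
      (is_hom_comp _ _ (corner_incl_hom n Hn) HJ)) _).
    refine (ge_trans _ (ge_sym (ge_homcomp (A:=B) (B:=KB) (C:=KZ) HeB HN (is_hom_comp _ _ HeB HN)))).
    apply (ge_homotopy (A:=B) (B:=KZ)). apply (incl_Ktensor_homotopic QB CE n Hn).
  - refine (ge_trans (ge_homcomp (A:=A) (B:=KB) (C:=KZ) (corner_incl_hom m Hm) HN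
      (is_hom_comp _ _ (corner_incl_hom m Hm) HN)) _).
    apply (ge_homotopy (A:=A) (B:=KZ)). apply (Ktensor_incl_homotopic QA QB CE m n Hn X f HX).
Qed.

Theorem theorem14p2 (G : group) (A B : Obj G) :
  morita (ocar A) (ocar B) -> gk_iso A B.
Proof.
  intros (E & F & m & n & HE & HF & CE & CF & Hm & Hn & (X & f & HX) & (Y & h & HY)).
  destruct (proj2_sig A) as [HA QA], (proj2_sig B) as [HB QB].
  eexists. eexists. split.
  (* This instance determines the two morphisms; exchanging [(A, E, m)] with [(B, F, n)] yields the
     same two in the opposite order. *)
  - apply (morita_composite_id A B QA QB CE CF m n Hm Hn X f HX).
  - apply (morita_composite_id B A QB QA CF CE n m Hn Hm Y h HY).
Qed.
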